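(* Let $H_{\mathbb{R}}$ be a finite dimensional real Hilbert space, let $q\in(-1,1)$ and $1\le p\le\infty$. If $|q|<\dim(H_{\mathbb{R}})^{-1/p}$, then the Ornstein-Uhlenbeck semi-group on the $q$-Gaussian algebra $\Gamma_q(H_{\mathbb{R}})$ is gradient-$\mathcal{S}_p$ (with respect to the $\ast$-subalgebra $\mathcal{A}_q$).
   Context: $q$-Gaussian algebras. $H=H_{\mathbb{R}}\otimes\mathbb{C}$. For $q\in(-1,1)$ let $P_q^n$ on $H^{\otimes n}$ be $P_q^n(\xi_1\otimes\dots\otimes\xi_n)=\sum_{\sigma\in S_n}q^{i(\sigma)}\xi_{\sigma(1)}\otimes\dots\otimes\xi_{\sigma(n)}$, with $i(\sigma)$ the number of inversions of $\sigma$. $H_q^{\otimes n}$ is $H^{\otimes n}$ with the inner product $\langle\xi,\eta\rangle_q=\langle P_q^n\xi,\eta\rangle$. The $q$-Fock space is $F_q(H)=\mathbb{C}\Omega\oplus\bigoplus_{n\ge1}H_q^{\otimes n}$ with $\Omega$ a unit vector. For $\xi\in H$ the bounded operator $l_q(\xi)$ on $F_q(H)$ is $l_q(\xi)(\eta_1\otimes\dots\otimes\eta_n)=\xi\otimes\eta_1\otimes\dots\otimes\eta_n$, $l_q(\xi)\Omega=\xi$. $\mathcal{A}_q$ is the unital $\ast$-algebra generated by $l_q(\xi)+l_q(\xi)^\ast$, $\xi\in H_{\mathbb{R}}$, and $\Gamma_q=\Gamma_q(H_{\mathbb{R}})=\mathcal{A}_q''$. The vacuum state $x\mapsto\langle x\Omega,\Omega\rangle$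 is a faithful normal trace on $\Gamma_q$ and $L_2(\Gamma_q)=F_q(H)$ with cyclic vector $\Omega$. For $\xi_1,\dots,\xi_n\in H$ there is a unique $W_q(\xi_1\otimes\dots\otimes\xi_n)\in\Gamma_q$ with $W_q(\xi_1\otimes\dots\otimes\xi_n)\Omega=\xi_1\otimes\dots\otimes\xi_n$; these operators (with $1=W_q(\Omega)$) lie in $\mathcal{A}_q$ and span it. The Ornstein-Uhlenbeck semi-group $(\Phi_t)_{t\ge0}$ is the semi-group of trace preserving normal unital completely positive maps on $\Gamma_q$ determined by $\Phi_t(W_q(\xi_1\otimes\dots\otimes\xi_n))=e^{-tn}W_q(\xi_1\otimes\dots\otimes\xi_n)$. Its generator $\Delta$ on $F_q(H)$ is the number operator, $\Delta(\xi_1\otimes\dots\otimes\xi_n)=n\,\xi_1\otimes\dots\otimes\xi_n$; correspondingly $\Delta(W_q(\xi_1\otimes\dots\otimes\xi_n))=n\,W_q(\xi_1\otimes\dots\otimes\xi_n)$ on $\mathcal{A}_q$. Gradient-$\mathcal{S}_p$. $\mathcal{S}_p$ is the Schatten-von Neumann class (the non-commutative $L_p$-space of $B(L_2)$ with its trace); for $p=\infty$, $\dim(H_{\mathbb{R}})^{-1/p}=1$. The semi-group is gradient-$\mathcal{S}_p$ if for all $a,b\in\mathcal{A}_q$ the map $x\Omega\mapsto\Psi^{a,b}(x)\Omega$, $x\in\mathcal{A}_q$, where $\Psi^{a,b}(x)=-\frac12\big(\Delta(axb)+a\Delta(x)b-\Delta(ax)b-a\Delta(xb)\big)$, extends to a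 bounded operator on $F_q(H)$ lying in $\mathcal{S}_p$. *)

(* Defs.v *)
From HB Require Import structures.
From mathcomp Require Import all_boot all_order all_algebra all_fingroup ring lra.
From mathcomp Require Import all_classical all_reals all_analysis.
From mathcomp.real_closed Require Import complex.

Set Implicit Arguments.
Unset Strict Implicit.
Unset Printing Implicit Defensive.

Import Order.TTheory GRing.Theory Num.Theory.
Import numFieldNormedType.Exports.
Local Open Scope ring_scope.
Local Open Scope complex_scope.

Section QFock.
Context {R : realType}.
Local Notation C := R[i].

Section Level.
Variables (d : nat) (q : R).
Implicit Types n : nat.

(* The complexification H is C^d in the coordinates of an orthonormal basis of
   H_R, and H^{(x)n} is the space of coefficient arrays indexed by words of
   length n. *)
Definition tens n := n.-tuple 'I_d -> C.

Definition wact n (w : n.-tuple 'I_d) (s : 'S_n) : n.-tuple 'I_d :=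
  [tuple tnth w (s i) | i < n].

Definition inversions n (s : 'S_n) : nat :=
  #|[set ij : 'I_n * 'I_n | (ij.1 < ij.2)%N && (s ij.2 < s ij.1)%N]|.

(* Linear extension of the formula on elementary tensors: the coefficient of
   xi_{s(1)} (x) ... (x) xi_{s(n)} at w is that of xi_1 (x) ... (x) xi_n at the
   word w o s^{-1}; see [Pq_elem] *)
Definition Pq n (x : tens n) : tens n := fun w =>
  \sum_(s : 'S_n) (q ^+ inversions s)%:C * x (wact w s^-1%g).

Definition dot0 n (x y : tens n) : C := \sum_w x w * (y w)^*.

Definition dotq n (x y : tens n) : C := dot0 (Pq x) y.

Definition elem n (xi : 'I_n -> 'rV[C]_d) : tens n :=
  fun w => \prod_(i < n) xi i 0 (tnth w i).

Lemma Pq_elem n (xi : 'I_n -> 'rV[C]_d) :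
  Pq (elem xi) =
  fun w => \sum_(s : 'S_n) (q ^+ inversions s)%:C * elem (xi \o s) w.
Proof.
apply/funext => w; apply: eq_bigr => s _; congr (_ * _).
rewrite /elem (reindex_inj (@perm_inj _ s)) /=; apply: eq_bigr => i _.
by rewrite tnth_mktuple permK.
Qed.

Lemma wactK n (s : 'S_n) : cancel ((@wact n)^~ s) ((@wact n)^~ s^-1%g).
Proof. by move=> w; apply: eq_from_tnth => i; rewrite !tnth_mktuple permKV. Qed.

Lemma wactM n w (s t : 'S_n) : wact (wact w s) t = wact w (t * s)%g.
Proof. by apply: eq_from_tnth => i; rewrite !tnth_mktuple permM. Qed.

Lemma inversionsM n (s t : 'S_n) :
  inversions (t^-1 * s)%g =
  #|[set ab : 'I_n * 'I_n |
      (ab.1 < ab.2)%N && ((s ab.1 < s ab.2)%N != (t ab.1 < t ab.2)%N)]|.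
Proof.
pose D (u v : 'S_n) := [set ab : 'I_n * 'I_n |
  (ab.1 < ab.2)%N && ((u ab.1 < u ab.2)%N != (v ab.1 < v ab.2)%N)].
pose E (u v : 'S_n) := [set ab : 'I_n * 'I_n |
  (u ab.1 < u ab.2)%N != (v ab.1 < v ab.2)%N].
pose sw (ab : 'I_n * 'I_n) := (ab.2, ab.1).
have swI : injective sw by move=> [a b] [c e] [-> ->].
have ltnN (u : 'S_n) a b : a != b -> (u b < u a)%N = ~~ (u a < u b)%N.
  by move=> ab; rewrite -leqNgt ltn_neqAle (inj_eq val_inj) (inj_eq perm_inj)
    eq_sym ab.
have ED u v : #|E u v| = (#|D u v|.*2)%N.
  have -> : E u v = D u v :|: sw @: D u v.
    apply/setP => -[a b]; rewrite !inE /=.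
    have -> : ((a, b) \in sw @: D u v) = ((b, a) \in D u v).
      by rewrite -[(a, b)]/(sw (b, a)) mem_imset.
    rewrite inE /=; have [->|ab] := eqVneq a b; first by rewrite !ltnn.
    have := ltnN 1%g _ _ ab; rewrite !perm1 => ->.
    rewrite !(ltnN _ _ _ ab).
    by case: (a < b)%N; case: (u a < u b)%N; case: (v a < v b)%N.
  rewrite cardsU card_imset // addnn.
  suff -> : D u v :&: sw @: D u v = finset.set0 by rewrite cards0 subn0.
  apply/setP => -[a b]; rewrite !inE /=.
  rewrite -[(a, b)]/(sw (b, a)) mem_imset // inE /=.
  by case: ltngtP; rewrite ?andbF.
apply: double_inj; rewrite -ED.
have -> : inversions (t^-1 * s)%g = #|D (t^-1 * s)%g 1%g|.
  rewrite /inversions; apply: eq_card => -[a b]; rewrite !inE /= !perm1.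
  case: (ltnP a b) => //= ab; have abn : a != b by rewrite -val_eqE /= ltn_eqF.
  by rewrite (ltnN _ _ _ abn); case: ltnP.
rewrite -ED -(card_imset _ (f := fun ab => (t^-1 ab.1, t^-1 ab.2)%g)); last first.
  by move=> [a b] [c e] /= [/perm_inj -> /perm_inj ->].
apply: eq_card => -[a b].
rewrite -[a in LHS](permK t) -[b in LHS](permK t).
rewrite -[(t^-1%g _, t^-1%g _)]/((fun ab => (t^-1 ab.1, t^-1 ab.2)%g) (t a, t b)).
rewrite mem_imset; last by move=> [? ?] [? ?] /= [/perm_inj -> /perm_inj ->].
by rewrite !inE /= !permM !perm1 !permK.
Qed.

(* inversions (t^-1 * s) counts the pairs on which s and t disagree, so
   q ^+ inversions (t^-1 * s) is a product of positive kernels, and P_q^n is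
   an average of this kernel over the symmetric group. *)
Lemma dotq_ge0 n (x : tens n) : `|q| <= 1 -> 0 <= dotq x x.
Proof.
rewrite ler_norml => /andP[q1 q2].
pose E := [set ab : 'I_n * 'I_n | (ab.1 < ab.2)%N].
pose bit (s : 'S_n) (ab : 'I_n * 'I_n) := (ab \in E) && (s ab.1 < s ab.2)%N.
pose sg s ab : C := (-1) ^+ bit s ab.
pose al : R := (1 + q) / 2; pose be : R := (1 - q) / 2.
have al0 : 0 <= al by rewrite divr_ge0 // -lerBlDl sub0r.
have be0 : 0 <= be by rewrite divr_ge0 // subr_ge0.
pose wt (J : {set 'I_n * 'I_n}) : R := \prod_ab if ab \in J then al else be.
pose chi (J : {set 'I_n * 'I_n}) s : C := \prod_ab if ab \in J then 1 else sg s ab.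
have chiJ J s : (chi J s)^*%R = chi J s.
  rewrite rmorph_prod; apply: eq_bigr => ab _; case: ifP => _; rewrite ?rmorph1 //.
  by rewrite rmorphXn rmorphN rmorph1.
have KE (s t : 'S_n) : (q ^+ inversions (t^-1 * s)%g)%:C =
    \sum_(J : {set 'I_n * 'I_n}) (wt J)%:C * (chi J s * chi J t).
  have -> : (q ^+ inversions (t^-1 * s)%g)%:C =
      \prod_ab (al%:C + be%:C * (sg s ab * sg t ab)).
    rewrite inversionsM -prodr_const rmorph_prod big_mkcond /=.
    apply: eq_bigr => ab _; rewrite /sg /bit !inE.
    have e1 : al + be = 1 by rewrite /al /be; field.
    have e2 : al - be = q by rewrite /al /be; field.
    case: (ab.1 < ab.2)%N => /=; last by rewrite !expr0 !mulr1 -rmorphD e1.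
    case: (s ab.1 < s ab.2)%N; case: (t ab.1 < t ab.2)%N => /=;
      rewrite ?expr0 ?expr1 ?mulrNN ?mulr1 ?mul1r ?mulrN1 ?mulr1 -?rmorphN -?rmorphD ?e1 ?e2 //.
  rewrite bigA_distr; apply: eq_big => [J|J _]; first by rewrite inE.
  rewrite /wt rmorph_prod /chi -!big_split /=; apply: eq_bigr => ab _.
  by case: ifP => _; rewrite ?mulr1.
have S (s t : 'S_n) : \sum_w x (wact w s^-1%g) * (x (wact w t^-1%g))^* =
   \sum_w x (wact w (t^-1 * s)^-1%g) * (x w)^*.
  rewrite (reindex_inj (can_inj (@wactK n t))) /=.
  apply: eq_bigr => w _; rewrite wactK; congr (x _ * _).
  by rewrite wactM invMg invgK.
suff: 0 <= (n`!)%:R * dotq x x by rewrite pmulr_rge0 // ltr0n fact_gt0.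
have -> : (n`!)%:R * dotq x x =
    \sum_(t : 'S_n) \sum_(s : 'S_n) (q ^+ inversions (t^-1 * s)%g)%:C *
      \sum_w x (wact w s^-1%g) * (x (wact w t^-1%g))^*.
  rewrite -card_Sn -[RHS]/(\sum_(t in 'S_n) _) mulr_natl -sumr_const.
  apply: eq_bigr => t _; rewrite (reindex_inj (mulgI t)) /=.
  rewrite /dotq /dot0.
  under [LHS]eq_bigr do rewrite /Pq mulr_suml.
  rewrite exchange_big /=.
  apply: eq_bigr => s _; rewrite S mulKg mulr_sumr.
  by apply: eq_bigr => w _; rewrite mulrA.
have -> : \sum_(t : 'S_n) \sum_(s : 'S_n) (q ^+ inversions (t^-1 * s)%g)%:C *
      \sum_w x (wact w s^-1%g) * (x (wact w t^-1%g))^* =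
    \sum_(J : {set 'I_n * 'I_n}) (wt J)%:C * \sum_w
      (\sum_s chi J s * x (wact w s^-1%g)) * (\sum_s chi J s * x (wact w s^-1%g))^*.
  under eq_bigr do under eq_bigr do rewrite KE mulr_suml.
  under eq_bigr do rewrite exchange_big; rewrite exchange_big /=.
  apply: eq_bigr => J _.
  rewrite [RHS]mulr_sumr.
  under [RHS]eq_bigr do rewrite rmorph_sum !mulr_sumr.
  rewrite [RHS]exchange_big /=; apply: eq_bigr => t _.
  under [RHS]eq_bigr do rewrite mulr_suml mulr_sumr.
  rewrite [RHS]exchange_big /=; apply: eq_bigr => s _.
  rewrite mulr_sumr; apply: eq_bigr => w _.
  by rewrite rmorphM /= chiJ; ring.
apply: sumr_ge0 => J _; apply: mulr_ge0.
  by rewrite ler0c; apply: prodr_ge0 => ab _; case: ifP.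
apply: sumr_ge0 => w _.
by rewrite -normCK exprn_ge0.
Qed.

End Level.

Section Hilbert.
Variables (V : lmodType C) (dot : V -> V -> C).

Definition hnorm (x : V) : R := Num.sqrt (complex.Re (dot x x)).

Definition bounded_op (T : V -> V) : Prop :=
  linear T /\ exists M : R, forall x, hnorm (T x) <= M * hnorm x.

Definition is_adjoint (T S : V -> V) : Prop :=
  forall x y, dot (T x) y = dot x (S y).

Definition orthonormal_basis (I : choiceType) (e : I -> V) : Prop :=
  (forall i j, dot (e i) (e j) = (i == j)%:R) /\
  (forall x, (forall i, dot x (e i) = 0) -> x = 0).

(* A = |T|: A is positive and A^2 = T^* T *)
Definition is_abs (T A : V -> V) : Prop :=
  [/\ bounded_op A, (forall x, 0 <= dot (A x) x) &
      forall x y, dot (A (A x)) y = dot (T x) (T y)].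

(* For p < oo: |T| is diagonal in some orthonormal basis with eigenvalues s i
   (for T compact this always holds), so that Tr(|T|^p) is the sum of the
   (s i)^p.  For p = +oo the eigenvalues, with multiplicity, tend to 0, i.e.
   S_oo is the ideal of compact operators. *)
Definition schatten (p : \bar R) (T : V -> V) : Prop :=
  bounded_op T /\
  exists (A : V -> V) (I : choiceType) (e : I -> V) (s : I -> R),
    [/\ is_abs T A, orthonormal_basis e,
        forall i, A (e i) = (s i)%:C *: e i &
        if p is r%:E then (\esum_(i in [set: I]) ((s i) `^ r)%:E < +oo)%E
        else forall eps : R, 0 < eps -> finite_set [set i | eps < s i]%classic].

End Hilbert.

Section Fock.
Variables (d : nat) (q : R).

(* Families (x_n)_n with x_n in H^{(x)n}, as functions on all words. *)
Definition words := seq 'I_d -> C.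

Definition level n (x : words) : tens d n := fun w => x w.
Arguments level n x : clear implicits.

Definition embed n (t : tens d n) : words := fun w => oapp t 0 (insub w).

(* The left creation operator; see [create_elem]. *)
Definition create (xi : 'rV[C]_d) (x : words) : words :=
  fun w => if w is i :: v then xi 0 i * x v else 0.

Lemma create_elem (xi : 'rV[C]_d) n (eta : 'I_n -> 'rV[C]_d) :
  create xi (embed (elem eta)) =
  embed (elem (fun i => oapp eta xi (unlift ord0 i))).
Proof.
apply/funext => -[|i v]; rewrite /create /embed; first by rewrite insubF.
case: insubP => [u /eqP sv uv|nsv] /=; last by rewrite mulr0 insubF //= eqSS (negPf nsv).
have siv : size (i :: v) == n.+1 by rewrite /= sv.
rewrite (insubT (fun s => size s == n.+1) siv) /= /elem big_ord_recl.
rewrite unlift_none /= (tnth_nth i) /=; congr (_ * _).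
by apply: eq_bigr => j _; rewrite liftK /= !(tnth_nth i) /= uv.
Qed.

Definition normsq_level (x : words) n : R := complex.Re (dotq q (level n x) (level n x)).

Definition square_summable : {pred words} :=
  fun x => `[< cvgn (series (normsq_level x)) >].

Hypothesis q1 : -1 < q < 1.

Lemma normsq_level_ge0 x n : 0 <= normsq_level x n.
Proof.
have : 0 <= dotq q (level n x) (level n x).
  by apply: dotq_ge0; rewrite ltW // ltr_norml.
by rewrite lecE => /andP[].
Qed.

Lemma embed_summable n (t : tens d n) : embed t \in square_summable.
Proof.
apply/asboolP.
have u0 k : k != n -> normsq_level (embed t) k = 0.
  move=> kn; rewrite /normsq_level /dotq /dot0 big1 // => w _.
  by rewrite /level /embed insubF ?rmorph0 ?mulr0 // size_tuple (negPf kn).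
apply/cvg_ex; exists (series (normsq_level (embed t)) n.+1).
apply: cvg_near_cst; near=> N.
rewrite /series /= (@big_cat_nat _ _ _ n.+1) //=; last by near: N; exact: nbhs_infty_ge.
by rewrite [X in _ + X]big1_seq ?addr0 // => k /andP[_];
  rewrite mem_index_iota => /andP[nk _]; rewrite u0 // gtn_eqF.
Unshelve. all: by end_near. Qed.

Let PqD x y n w : Pq q (level n (x + y)) w =
  Pq q (level n x) w + Pq q (level n y) w.
Proof. by rewrite /Pq -big_split /=; apply: eq_bigr => s _; rewrite mulrDr. Qed.

Let PqZ c x n w : Pq q (level n (c *: x)) w = c * Pq q (level n x) w.
Proof. by rewrite /Pq mulr_sumr; apply: eq_bigr => s _; rewrite mulrCA. Qed.

Let normsq_levelZ c x n :
  normsq_level (c *: x) n = complex.Re (c * c^*%R) * normsq_level x n.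
Proof.
rewrite /normsq_level /dotq /dot0; under eq_bigr do rewrite PqZ.
have -> : \sum_(w : n.-tuple 'I_d) c * Pq q (level n x) w * (level n (c *: x) w)^* =
    c * c^*%R * \sum_(w : n.-tuple 'I_d) Pq q (level n x) w * (level n x w)^*.
  by rewrite mulr_sumr; apply: eq_bigr => w _; rewrite rmorphM /=; ring.
by rewrite -normCK -add_Re2_Im2; case: (\sum_w _) => u v /=; rewrite mul0r subr0.
Qed.

Let normsq_levelD_le x y n :
  normsq_level (x + y) n <= 2 * normsq_level x n + 2 * normsq_level y n.
Proof.
rewrite -subr_ge0; suff <- : normsq_level (x + (-1) *: y) n =
    2 * normsq_level x n + 2 * normsq_level y n - normsq_level (x + y) n.
  exact: normsq_level_ge0.
have ReD (u v : C) : complex.Re (u + v) = complex.Re u + complex.Re v.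
  by case: u v => [? ?] [].
apply/eqP; rewrite eq_sym subr_eq; apply/eqP.
rewrite /normsq_level !mulr_natl !mulr2n -!ReD; congr complex.Re.
rewrite /dotq /dot0 -!big_split /=; apply: eq_bigr => w _.
by rewrite !PqD PqZ /level /= !rmorphD !rmorphM /= rmorphN rmorph1; ring.
Qed.

Lemma square_summable_submod : subsemimod_closed square_summable.
Proof.
split; first split.
- apply/asboolP; have -> : normsq_level 0 = 0.
    apply/funext => n; rewrite -[X in normsq_level X](scale0r 0) normsq_levelZ.
    by rewrite mul0r mul0r.
  rewrite /series /=; under eq_fun do rewrite big1 //; exact: is_cvg_cst.
- move=> x y /asboolP cx /asboolP cy; apply/asboolP.
  apply: (series_le_cvg _ _ (normsq_levelD_le x y)) => [n|n|].
  + exact: normsq_level_ge0.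
  + by rewrite addr_ge0 // mulr_ge0 // normsq_level_ge0.
  apply: is_cvg_seriesD; exact: is_cvg_seriesZ.
- move=> c x /asboolP cx; apply/asboolP.
  have -> : normsq_level (c *: x) = complex.Re (c * c^*%R) *: normsq_level x.
    by apply/funext => n; rewrite normsq_levelZ.
  exact: is_cvg_seriesZ.
Qed.

End Fock.
Arguments level {d} n x.

(* F_q(H): the levels H_q^{(x)n} being finite dimensional, the completion of
   their orthogonal sum consists of the square summable families. *)
Record qFock d q (q1 : -1 < q < 1) :=
  QFock { qFock_val :> words d; qFock_valP : qFock_val \in square_summable q }.
HB.instance Definition _ d q (q1 : -1 < q < 1) :=
  [isSub for @qFock_val d q q1].
HB.instance Definition _ d q (q1 : -1 < q < 1) :=
  [Choice of @qFock d q q1 by <:].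
HB.instance Definition _ d q (q1 : -1 < q < 1) :=
  GRing.SubChoice_isSubLmodule.Build C (words d) (square_summable q)
    (@qFock d q q1) (square_summable_submod d q1).


Section Gaussian.
Variables (HR : vectType R) (ip : HR -> HR -> R).
Variables (d : nat) (e : 'I_d -> HR).
Variables (q : R) (q1 : -1 < q < 1).
Local Notation F := (qFock d q1).

(* <x, y>_q = sum_n <P_q^n x_n, y_n>, linear in x; the limit is taken separately
   on real and imaginary parts because R[i] carries no canonical topology. *)
Definition qdot (x y : F) : C :=
  limn (series (fun n => complex.Re (dotq q (level n x) (level n y)))) +i*
  limn (series (fun n => complex.Im (dotq q (level n x) (level n y)))).

Definition tensor n (xi : 'I_n -> 'rV[C]_d) : F :=
  QFock q1 (embed_summable q (elem xi)).

Definition vacuum : F := tensor (fun _ : 'I_0 => 0).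

(* H_R -> H in the coordinates of the orthonormal basis e *)
Definition cplx (xi : HR) : 'rV[C]_d := \row_i (ip xi (e i))%:C.

(* L = l_q(xi) *)
Definition is_creation (xi : 'rV[C]_d) (L : F -> F) : Prop :=
  forall x, L x = create xi x :> words d.

Inductive Aq : (F -> F) -> Prop :=
| Aq_gaussian (xi : HR) (L Ls : F -> F) :
    is_creation (cplx xi) L -> is_adjoint qdot L Ls -> Aq (L + Ls)
| Aq_one : Aq id
| Aq_add a b : Aq a -> Aq b -> Aq (a + b)
| Aq_scale (c : C) a : Aq a -> Aq (c *: a)
| Aq_mul a b : Aq a -> Aq b -> Aq (a \o b)
| Aq_adjoint a b : Aq a -> is_adjoint qdot a b -> Aq b.

(* The restriction of Delta to A_q is linear, and Delta W = n W for
   W = W_q(xi_1 (x) ... (x) xi_n), the element of A_q sending the vacuum to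
   xi_1 (x) ... (x) xi_n.  Since these W span A_q, this determines Delta on
   A_q; its values elsewhere are irrelevant. *)
Definition is_OU_generator (Delta : (F -> F) -> (F -> F)) : Prop :=
  (forall (c : C) x y, Aq x -> Aq y ->
     Delta (c *: x + y) = c *: Delta x + Delta y) /\
  (forall n (xi : 'I_n -> 'rV[C]_d) (W : F -> F),
     Aq W -> W vacuum = tensor xi -> Delta W = n%:R *: W).

Definition Psi (Delta : (F -> F) -> (F -> F)) (a b x : F -> F) : F -> F :=
  - (2^-1 : C) *: (Delta (a \o x \o b) + (a \o Delta x \o b)
                   - (Delta (a \o x) \o b) - (a \o Delta (x \o b))).

(* The vectors x Omega, x in A_q, are dense, so T is the only possible bounded
   extension of x Omega |-> Psi^{a,b}(x) Omega. *)
Definition gradient_schatten (Delta : (F -> F) -> (F -> F)) (p : \bar R) :=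
  forall a b, Aq a -> Aq b ->
  exists T : F -> F, schatten qdot p T /\
    forall x, Aq x -> T (x vacuum) = Psi Delta a b x vacuum.

End Gaussian.

(* n^{-1/p}, with value 1 for p = +oo, and +oo for n = 0 and p < +oo *)
Definition dim_root (n : nat) (p : \bar R) : \bar R :=
  ((n%:R `^ fine p^-1)%:E^-1)%E.

End QFock.
Arguments level {R d} n x.

(* Main.v *)
(* Write l_i, r_i for the left and right creation operators of an orthonormal
   basis and N for the number operator.  With R_b the right multiplication by b,
   the map x Omega |-> Psi^{a,b}(x) Omega is -1/2 [[N, a], R_b].  Commutators
   are derivations in a and in b, so it suffices to treat the generators, where
   [l_i - l_i^*, r_j + r_j^*] = -2 delta_ij q^N.  Hence the operator is a sum of
   products A q^N B with A, B bounded and moving levels by a bounded amount, and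
   its restriction to the levels >= n has norm at most c |q|^n.  By a dimension
   count, |T| then has at most 1 + d + ... + d^(n-1) eigenvalues larger than
   c |q|^n, and the sum of their p-th powers is finite when |q|^p d < 1.  The
   diagonalization of |T| is the spectral theorem for compact positive operators,
   applied to T^* T. *)
Require Import Defs.
From mathcomp Require Import all_boot all_order all_algebra all_fingroup ring lra.
From mathcomp Require Import all_classical all_reals all_analysis.
From mathcomp.real_closed Require Import complex.
From mathcomp Require Import finmap.

Set Implicit Arguments.
Unset Strict Implicit.
Unset Printing Implicit Defensive.

Import Order.TTheory GRing.Theory Num.Theory.
Import numFieldNormedType.Exports.
Local Open Scope ring_scope.
Local Open Scope complex_scope.

(** * Positive semidefinite Hermitian forms *)

(** The number operator N is unbounded, so it is never an operator on [qFock]: it acts on arbitrary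
    families, and only [N, a], which is bounded, is realized on the space. The generator is
    prescribed on Wick words alone; the vacuum separates the left algebra, so each element of [Aq]
    is a finite combination of Wick words and its image under [Delta] is forced. Right
    multiplication by b is bounded because the algebra generated by the r_j + r_j^* commutes with
    the left one and reaches the same vectors from the vacuum.

    The pair expansion bounds P_q^n below by (1 - |q|)^(n^2). This degenerates as n grows, but it
    serves only for definiteness and for finitely many coordinates at a time; operator norms come
    from l^* l = 1 + q l l^* instead.

    The decay rate is some t > 0 with |q| <= t and, for finite p, t^p d < 1: shifting levels by m
    costs t^-m, which rules out t = 0 even when q = 0. The spectral theorem rests on weak
    compactness of bounded sequences, which the Fock space gets from coordinatewise limits. *)

Section ComplexRe.
Context {R : realType}.
Local Notation C := R[i].
Implicit Types (a : R) (z w : C).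

Lemma ReD z w : complex.Re (z + w) = complex.Re z + complex.Re w.
Proof. by case: z w => [? ?] []. Qed.

Lemma ReN z : complex.Re (- z) = - complex.Re z.
Proof. by case: z. Qed.

Lemma ReMreal a z : complex.Re (a%:C * z) = a * complex.Re z.
Proof. by case: z => u v /=; rewrite mul0r subr0. Qed.

Lemma Re_sum (I : Type) (r : seq I) (P : pred I) (F : I -> C) :
  complex.Re (\sum_(i <- r | P i) F i) = \sum_(i <- r | P i) complex.Re (F i).
Proof. by apply: (big_morph _ ReD). Qed.

Lemma Re_conj z : complex.Re z^*%R = complex.Re z.
Proof. by case: z. Qed.

Lemma conj_realc a : (a%:C)^*%R = a%:C.
Proof. by apply/CrealP; rewrite complex_real. Qed.

Definition cmod z : R := complex.Re `|z|.

Lemma cmodE z : `|z| = (cmod z)%:C.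
Proof. by rewrite /cmod normc_def. Qed.

Lemma cmod_ge0 z : 0 <= cmod z.
Proof. by rewrite -ler0c -cmodE. Qed.

Lemma cmod_sq z : (cmod z ^+ 2)%:C = z * z^*%R.
Proof. by rewrite rmorphXn /= -cmodE normCK. Qed.

Lemma cmod_eq0 z : cmod z = 0 -> z = 0.
Proof. by move=> z0; apply/normr0_eq0; rewrite cmodE z0. Qed.

Lemma cmod_real a : cmod a%:C = `|a|.
Proof. by rewrite /cmod normc_def /= expr0n addr0 sqrtr_sqr. Qed.

Lemma cmod0 : cmod 0 = 0. Proof. by rewrite (cmod_real 0) normr0. Qed.

Lemma cmodM z w : cmod (z * w) = cmod z * cmod w.
Proof. by apply: complexI; rewrite rmorphM /= -!cmodE normrM. Qed.

Lemma cmod_ge_Re z : `|complex.Re z| <= cmod z.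
Proof. by rewrite -lecR -cmodE normc_ge_Re. Qed.

Lemma cmod_le_ReIm z : cmod z <= `|complex.Re z| + `|complex.Im z|.
Proof.
rewrite /cmod normc_def /= -ler_sqr ?nnegrE ?sqrtr_ge0 ?addr_ge0 //.
rewrite sqr_sqrtr ?addr_ge0 ?sqr_ge0 // sqrrD !real_normK ?num_real //.
by rewrite lerD2r lerDl mulrn_wge0 ?mulr_ge0.
Qed.

End ComplexRe.

Section LinearFun.
Variables (K : pzRingType) (U W : lmodType K) (f : U -> W).
Hypothesis linf : linear f.

Lemma lin0 : f 0 = 0.
Proof. by have := linf (-1) 0 0; rewrite scaler0 addr0 scaleN1r addNr. Qed.

Lemma linD x y : f (x + y) = f x + f y.
Proof. by have := linf 1 x y; rewrite !scale1r. Qed.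

Lemma linZ c x : f (c *: x) = c *: f x.
Proof. by have := linf c x 0; rewrite lin0 !addr0. Qed.

Lemma linB x y : f (x - y) = f x - f y.
Proof. by rewrite linD -scaleN1r linZ scaleN1r. Qed.

End LinearFun.

Section PsdForm.
Context {R : realType} {V : lmodType R[i]}.
Local Notation C := R[i].

(** Only semidefinite: [qform n] sees just the words of length n, so it is degenerate on the space
    of all families. *)
Record psd_form (f : V -> V -> C) : Prop := PsdForm {
  psdDl : forall x y z, f (x + y) z = f x z + f y z;
  psdZl : forall c x z, f (c *: x) z = c * f x z;
  psdC : forall x y, f y x = (f x y)^*%R;
  psd_ge0 : forall x, 0 <= f x x }.

Variables (f : V -> V -> C) (F : psd_form f).
Implicit Types (x y z : V) (a : R) (c : C).

Definition rform x y : R := complex.Re (f x y).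
Local Notation rf := rform.
Local Notation hn := (hnorm f).

Lemma psdDr x y z : f z (x + y) = f z x + f z y.
Proof. by rewrite !(psdC F _ z) (psdDl F) rmorphD. Qed.

Lemma psdZr c x z : f z (c *: x) = c^*%R * f z x.
Proof. by rewrite !(psdC F _ z) (psdZl F) rmorphM. Qed.

Lemma psd0l z : f 0 z = 0.
Proof. by rewrite -(scale0r (0 : V)) (psdZl F) mul0r. Qed.

Lemma psd0r z : f z 0 = 0.
Proof. by rewrite (psdC F) psd0l rmorph0. Qed.

Lemma psdNl x z : f (- x) z = - f x z.
Proof. by rewrite -scaleN1r (psdZl F) mulN1r. Qed.

Lemma psdNr x z : f z (- x) = - f z x.
Proof. by rewrite !(psdC F _ z) psdNl rmorphN. Qed.

Lemma psdBl x y z : f (x - y) z = f x z - f y z.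
Proof. by rewrite (psdDl F) psdNl. Qed.

Lemma psd_suml (I : Type) (r : seq I) (P : pred I) (u : I -> V) z :
  f (\sum_(i <- r | P i) u i) z = \sum_(i <- r | P i) f (u i) z.
Proof. by apply: (big_morph (f^~ z)) => [x y|]; [exact: psdDl|exact: psd0l]. Qed.

Lemma psd_sumr (I : Type) (r : seq I) (P : pred I) (u : I -> V) z :
  f z (\sum_(i <- r | P i) u i) = \sum_(i <- r | P i) f z (u i).
Proof. by apply: (big_morph (f z)) => [x y|]; [exact: psdDr|exact: psd0r]. Qed.

Lemma rformC x y : rf x y = rf y x.
Proof. by rewrite /rf [f y x](psdC F) Re_conj. Qed.

Lemma rformDl x y z : rf (x + y) z = rf x z + rf y z.
Proof. by rewrite /rf (psdDl F) ReD. Qed.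

Lemma rformDr x y z : rf z (x + y) = rf z x + rf z y.
Proof. by rewrite /rf psdDr ReD. Qed.

Lemma rformNl x z : rf (- x) z = - rf x z.
Proof. by rewrite /rf psdNl ReN. Qed.

Lemma rformNr x z : rf z (- x) = - rf z x.
Proof. by rewrite /rf psdNr ReN. Qed.

Lemma rformZl a x z : rf (a%:C *: x) z = a * rf x z.
Proof. by rewrite /rf (psdZl F) ReMreal. Qed.

Lemma rformZr a x z : rf z (a%:C *: x) = a * rf z x.
Proof. by rewrite !(rformC z) rformZl. Qed.

Lemma rform_ge0 x : 0 <= rf x x.
Proof. by have := psd_ge0 F x; rewrite lecE => /andP[]. Qed.

Lemma rform_diag x : f x x = (rf x x)%:C.
Proof.
by rewrite /rf RRe_real //; apply/CrealP; rewrite -(psdC F).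
Qed.

Lemma hnorm_ge0 x : 0 <= hn x. Proof. exact: sqrtr_ge0. Qed.

Lemma hnorm_sq x : hn x ^+ 2 = rf x x.
Proof. by rewrite sqr_sqrtr // rform_ge0. Qed.

Lemma hnorm0 : hn 0 = 0.
Proof. by rewrite /hnorm psd0l sqrtr0. Qed.

Lemma cauchy_schwarz x y : rf x y ^+ 2 <= rf x x * rf y y.
Proof.
have h (t : R) : 0 <= rf x x + t * rf x y *+ 2 + t ^+ 2 * rf y y.
  have := rform_ge0 (x + t%:C *: y).
  by rewrite !(rformDl, rformDr, rformZl, rformZr) (rformC y x) => /le_trans -> //; lra.
have yy := rform_ge0 y; have xx := rform_ge0 x.
have [y0|y0] := eqVneq (rf y y) 0.
  rewrite y0 mulr0 le_eqVlt sqrf_eq0; have [//|b0] := eqVneq (rf x y) 0.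
  (* With [rf y y = 0] the polynomial in [t] is affine, and this [t] gives it the value -1. *)
  have := h (- (rf x x + 1) / (rf x y *+ 2)); rewrite y0 mulr0 addr0.
  suff -> : - (rf x x + 1) / (rf x y *+ 2) * rf x y *+ 2 = - (rf x x + 1) by lra.
  by rewrite -mulrnAr divfK // mulrn_eq0.
have yp : 0 < rf y y by rewrite lt_def y0.
have := h (- rf x y / rf y y); rewrite -(pmulr_lge0 _ yp).
have -> : (rf x x + - rf x y / rf y y * rf x y *+ 2 +
    (- rf x y / rf y y) ^+ 2 * rf y y) * rf y y = rf x x * rf y y - rf x y ^+ 2.
  by field.
by rewrite subr_ge0.
Qed.

Lemma rform_le_hnorm x y : `|rf x y| <= hn x * hn y.
Proof.
rewrite -ler_sqr ?nnegrE ?mulr_ge0 ?hnorm_ge0 // exprMn !hnorm_sq.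
by rewrite real_normK ?num_real // cauchy_schwarz.
Qed.

Lemma hnormD x y : hn (x + y) <= hn x + hn y.
Proof.
rewrite -ler_sqr ?nnegrE ?addr_ge0 ?hnorm_ge0 // hnorm_sq !(rformDl, rformDr) (rformC y x).
rewrite -!hnorm_sq sqrrD; have := le_trans (ler_norm _) (rform_le_hnorm x y); lra.
Qed.

Lemma hnormZ c x : hn (c *: x) = cmod c * hn x.
Proof.
apply/eqP; rewrite -(eqrXn2 (n := 2)) ?hnorm_ge0 ?mulr_ge0 ?cmod_ge0 ?hnorm_ge0 //.
rewrite exprMn !hnorm_sq; apply/eqP/complexI.
by rewrite rmorphM /= cmod_sq -!rform_diag (psdZl F) psdZr; ring.
Qed.

Lemma hnormN x : hn (- x) = hn x.
Proof. by rewrite /hnorm psdNl psdNr opprK. Qed.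

Lemma hnormB x y : hn (x - y) <= hn x + hn y.
Proof. by rewrite -(hnormN y); exact: hnormD. Qed.

End PsdForm.

(** * The q-deformed form on words *)

Section Inversions.
Variable n : nat.
Implicit Types s t : 'S_n.

Lemma inversionsV s : inversions s^-1%g = inversions s.
Proof.
rewrite -[in LHS](mulg1 s^-1%g) inversionsM; apply: eq_card => -[a b].
rewrite !inE /= !perm1; case: (ltnP a b) => //= ab.
rewrite -leqNgt leq_eqVlt (inj_eq val_inj) (inj_eq perm_inj).
by rewrite -val_eqE gtn_eqF // orFb; case: ltnP.
Qed.

(** The pair (a, b) corresponds to (rev b, rev a), for which both comparisons are reversed twice.
    Hence reversal of words respects the q-form. *)
Lemma inversions_rev s :
  inversions (perm rev_ord_inj * s * perm rev_ord_inj)%g = inversions s.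
Proof.
set r := perm rev_ord_inj.
pose f (ab : 'I_n * 'I_n) := (rev_ord ab.2, rev_ord ab.1).
have fK : involutive f by case=> a b; rewrite /f /= !rev_ordK.
have ltr (a b : 'I_n) : (rev_ord a < rev_ord b)%N = (b < a)%N.
  by rewrite /= ltn_sub2lE ?ltnS ?ltn_ord.
rewrite /inversions -(card_imset _ (inv_inj fK)); apply: eq_card => -[a b].
rewrite -[(a, b)]fK (mem_imset _ _ (inv_inj fK)) !inE /= ltr !permM !permE.
rewrite -[(n - _.+1)%N]/(rev_ord (rev_ord a) : nat).
by rewrite -[(n - (n - b.+1).+1)%N]/(rev_ord (rev_ord b) : nat) !rev_ordK ltr.
Qed.

End Inversions.

(** Position [k] carries the value 0, so it is inverted with each of the [k] positions before it and
    with none after it; the other inversions are those of [s]. This is the source of the weights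
    [q ^+ k] in [lannih]. *)
Lemma inversions_lift n (k : 'I_n.+1) (s : 'S_n) :
  inversions (lift_perm k ord0 s) = (k + inversions s)%N.
Proof.
set t := lift_perm k ord0 s.
pose A := [set ab : 'I_n.+1 * 'I_n.+1 |
  (ab.1 < ab.2)%N && (t ab.2 < t ab.1)%N].
pose f (a : 'I_k) : 'I_n.+1 * 'I_n.+1 := (widen_ord (ltnW (ltn_ord k)) a, k).
pose g (ab : 'I_n * 'I_n) := (lift k ab.1, lift k ab.2).
have fI : injective f by move=> a b [] /val_inj.
have gI : injective g
    by move=> [a b] [c e] /pair_equal_spec[/lift_inj/= -> /lift_inj/= ->].
have ltl (h : 'I_n.+1) (a b : 'I_n) : (lift h a < lift h b)%N = (a < b)%N.
  by rewrite !ltnNge /= leq_bump2.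
have -> : inversions t = #|A| by [].
have -> : A = f @: finset.setT :|: g @: [set ab : 'I_n * 'I_n |
    (ab.1 < ab.2)%N && (s ab.2 < s ab.1)%N].
  apply/setP => -[a b]; rewrite !inE /=; apply/idP/idP.
    case: (unliftP k b) => [b' ->|->]; case: (unliftP k a) => [a' ->|->];
        rewrite /t ?lift_perm_lift ?lift_perm_id.
    - rewrite !ltl => h; apply/orP; right.
      by rewrite -[(_, _)]/(g (a', b')) mem_imset // inE.
    - by rewrite ltn0 andbF.
    - move=> /andP[ak _]; apply/orP; left; apply/imsetP.
      by exists (Ordinal ak) => //; congr pair; apply: val_inj.
    - by rewrite ltnn.
  case/orP => /imsetP[[]].
    move=> a' ak _ [-> ->] /=; rewrite ak /t lift_perm_id.
    case: (unliftP k (widen_ord (ltnW (ltn_ord k)) (Ordinal ak))) => [c ->|].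
      by rewrite lift_perm_lift.
    by move=> /(congr1 val) /= e; exfalso; move: (ltn_eqF ak); rewrite e eqxx.
  by move=> a' b' /[!inE] /= h [-> ->]; rewrite /t !lift_perm_lift !ltl.
rewrite cardsU !card_imset // cardsT card_ord.
suff -> : #|f @: finset.setT :&: g @: [set ab : 'I_n * 'I_n |
    (ab.1 < ab.2)%N && (s ab.2 < s ab.1)%N]| = 0%N by rewrite subn0.
apply/eqP; rewrite cards_eq0; apply/set0Pn => -[[a b]].
rewrite inE => /andP[/imsetP[a' _ [_ ->]] /imsetP[[c e] _ [_ /eqP]]].
by rewrite (negPf (neq_lift _ _)).
Qed.

Section Insertion.
Variables (T : Type) (x0 : T).

Definition insert_at k (i : T) (w : seq T) := take k w ++ i :: drop k w.

Lemma size_insert_at k i w : size (insert_at k i w) = (size w).+1.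
Proof. by rewrite size_cat /= addnS -size_cat cat_take_drop. Qed.

Lemma nth_insert_at k i w : (k <= size w)%N -> nth x0 (insert_at k i w) k = i.
Proof. by move=> kw; rewrite nth_cat size_takel // ltnn subnn. Qed.

Lemma nth_insert_at_bump k i w j : (k <= size w)%N ->
  nth x0 (insert_at k i w) (bump k j) = nth x0 w j.
Proof.
move=> kw; rewrite nth_cat size_takel // /bump; case: (leqP k j) => jk.
  by rewrite ltnNge ltnW ?ltnS // add1n subSn //= nth_drop subnKC.
by rewrite add0n jk nth_take.
Qed.

Lemma insert_at0 i w : insert_at 0 i w = i :: w.
Proof. by rewrite /insert_at take0 drop0. Qed.

Lemma insert_at_rcons k i j w : (k <= size w)%N ->
  insert_at k i (rcons w j) = rcons (insert_at k i w) j.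
Proof.
by move=> kw; rewrite /insert_at drop_rcons // -cats1 takel_cat // rcons_cat.
Qed.

Lemma insert_at_size i w : insert_at (size w) i w = rcons w i.
Proof. by rewrite /insert_at take_size drop_size cats1. Qed.

End Insertion.

Section PermSums.
Variables (A : nmodType).

Lemma sum_tuple_cons (T : finType) n (f : n.+1.-tuple T -> A) :
  \sum_v f v = \sum_i \sum_u f (cons_tuple i u).
Proof.
rewrite pair_big /= (reindex (fun p : T * n.-tuple T => cons_tuple p.1 p.2)) //=.
exists (fun t => (thead t, behead_tuple t)) => [[i u] _|t _] /=.
  by congr pair; apply: val_inj.
by rewrite [RHS]tuple_eta; apply: val_inj.
Qed.

(** Sorts permutations by the position [k] of the value 0. Injectivity and (n+1)! = (n+1) n! make
    the parametrization bijective. *)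
Lemma sum_perm_lift n (f : 'S_n.+1 -> A) :
  \sum_s f s = \sum_(k : 'I_n.+1) \sum_(s : 'S_n) f (lift_perm k ord0 s).
Proof.
pose g (p : 'I_n.+1 * 'S_n) := lift_perm p.1 ord0 p.2.
have gI : injective g.
  move=> [k s] [l t]; rewrite /g /= => e.
  have kl : k = l.
    apply: (@perm_inj _ (lift_perm k ord0 s)).
    by rewrite lift_perm_id e lift_perm_id.
  move: e; rewrite -kl => /permP e; congr pair; apply/permP => i.
  by have := e (lift k i); rewrite !lift_perm_lift => /lift_inj.
rewrite pair_big /= (reindex g) //; apply/onW_bij/inj_card_bij => //.
by rewrite card_prod card_ord; have := card_Sn n.+1; rewrite factS -(card_Sn n) => ->.
Qed.

End PermSums.

(** * Creation and annihilation operators on words *)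

Section Words.
Context {R : realType}.
Variables (d : nat) (q : R).
Local Notation C := R[i].
Local Notation words := (@words R d).
Implicit Types (x y : words) (i j : 'I_d).

Definition qform n x y : C := dotq q (level n x) (level n y).
Definition qsqnorm n x : R := complex.Re (qform n x x).

(* [lannih] is the adjoint of [lcreate] for the q-deformed form; reversal of
   words is an isometry exchanging the left and the right operators. *)
Definition lcreate i x : words := create (delta_mx 0 i) x.
Definition lannih i x : words := fun w =>
  \sum_(0 <= k < (size w).+1) (q ^+ k)%:C * x (insert_at k i w).
Definition wrev x : words := fun w => x (rev w).
Definition rcreate i x : words := wrev (lcreate i (wrev x)).
Definition rannih i x : words := wrev (lannih i (wrev x)).
(* q^N, with N the number operator *)
Definition qnumber x : words := fun w => (q ^+ size w)%:C * x w.

Lemma lcreate_cons i x j w : lcreate i x (j :: w) = (j == i)%:R * x w.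
Proof. by rewrite /lcreate /= mxE eqxx. Qed.

Lemma lcreate_nil i x : lcreate i x [::] = 0. Proof. by []. Qed.

Lemma wrevK : involutive wrev.
Proof. by move=> x; apply/funext => w; rewrite /wrev revK. Qed.

Lemma rcreate_rcons i x j w : rcreate i x (rcons w j) = (j == i)%:R * x w.
Proof. by rewrite /rcreate /wrev rev_rcons lcreate_cons revK. Qed.

Lemma rcreate_nil i x : rcreate i x [::] = 0. Proof. by []. Qed.

(** Insertion in front gives the identity term; any other insertion happens behind the created
    letter and pays one extra factor q. *)
Lemma lannih_lcreate i x : lannih i (lcreate i x) = x + q%:C *: lcreate i (lannih i x).
Proof.
apply/funext => w; rewrite /lannih !fctE big_nat_recl // insert_at0 lcreate_cons eqxx !mul1r.
congr (_ + _).
case: w => [|j w]; first by rewrite big_geq // lcreate_nil scaler0.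
rewrite lcreate_cons /= [_ *: _]mulrA mulr_sumr; apply: eq_bigr => k _.
by rewrite mxE eqxx exprS rmorphM /insert_at /=; ring.
Qed.

(** All insertions before the last letter ignore that letter; the insertion behind it removes the
    letter created by [rcreate] and has weight q to the length of the word. This single term is
    where q^N comes from. *)
Lemma lannih_rcreate i j x :
  lannih i (rcreate j x) = rcreate j (lannih i x) + (i == j)%:R *: qnumber x.
Proof.
apply/funext => w; rewrite /lannih !fctE /qnumber big_nat_recr //= insert_at_size.
rewrite rcreate_rcons [_ *: _]mulrCA; congr (_ + _).
case/lastP: w => [|w k]; first by rewrite big_geq.
rewrite rcreate_rcons size_rcons mulr_sumr; apply: eq_big_nat => l /andP[_ lw].
by rewrite insert_at_rcons // rcreate_rcons; ring.
Qed.

Lemma lcreate_rcreate i j x : lcreate i (rcreate j x) = rcreate j (lcreate i x).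
Proof.
apply/funext => -[|k w] //; rewrite lcreate_cons.
case/lastP: w => [|w l].
  by rewrite -[[:: k]]/(rcons [::] k) rcreate_rcons rcreate_nil lcreate_nil !mulr0.
by rewrite rcreate_rcons -rcons_cons rcreate_rcons lcreate_cons; ring.
Qed.

Lemma qnumber_wrev x : qnumber (wrev x) = wrev (qnumber x).
Proof. by apply/funext => w; rewrite /qnumber /wrev size_rev. Qed.

Lemma rannih_lcreate i j x :
  rannih i (lcreate j x) = lcreate j (rannih i x) + (i == j)%:R *: qnumber x.
Proof.
have -> : lcreate j x = wrev (rcreate j (wrev x)) by rewrite /rcreate !wrevK.
rewrite /rannih wrevK lannih_rcreate.
have -> : lcreate j (wrev (lannih i (wrev x))) = wrev (rcreate j (lannih i (wrev x))).
  by rewrite /rcreate wrevK.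
by rewrite qnumber_wrev; apply/funext => w; rewrite /wrev !fctE revK.
Qed.

End Words.

(** * Recursion and symmetries of the q-form *)

Section Forms.
Context {R : realType}.
Variables (d : nat).
Local Notation C := R[i].
Local Notation words := (@words R d).
Implicit Types (q : R) (x y : words) (i j : 'I_d).

(** A change of variable in each term moves the symmetrization to the second argument, where
    [lannih] is to appear. *)
Lemma dotqE q n (x y : tens d n) :
  dotq q x y =
  \sum_v x v * (\sum_(s : 'S_n) (q ^+ inversions s)%:C * y (wact v s))^*.
Proof.
rewrite /dotq /dot0 /Pq.
under eq_bigr do rewrite mulr_suml.
under [RHS]eq_bigr do rewrite rmorph_sum mulr_sumr.
rewrite exchange_big [RHS]exchange_big /=; apply: eq_bigr => s _.
rewrite (reindex_inj (can_inj (wactK s))) /=; apply: eq_bigr => w _.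
by rewrite wactK rmorphM /= conj_realc; ring.
Qed.

Lemma tval_wact_lift n (k : 'I_n.+1) (s : 'S_n) i (u : n.-tuple 'I_d) :
  wact (cons_tuple i u) (lift_perm k ord0 s) = insert_at k i (wact u s) :> seq _.
Proof.
have kn : (k <= size (wact u s))%N by rewrite size_tuple -ltnS.
apply: (@eq_from_nth _ i) => [|j].
  by rewrite size_insert_at !size_tuple.
rewrite size_tuple => jn; rewrite -[j]/(nat_of_ord (Ordinal jn)) -tnth_nth.
rewrite tnth_mktuple; case: (unliftP k (Ordinal jn)) => [l|] ->.
  rewrite lift_perm_lift nth_insert_at_bump // -tnth_nth tnth_mktuple.
  by rewrite !(tnth_nth i).
by rewrite lift_perm_id nth_insert_at.
Qed.

(** Permutations are sorted by the position [k] at which the first letter [i] is read in the right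
    argument; the [k] inversions created there are the factor q^k of [lannih]. *)
Lemma qformS q n x y : qform q n.+1 x y = \sum_i qform q n (fun w => x (i :: w)) (lannih q i y).
Proof.
rewrite /qform dotqE sum_tuple_cons; apply: eq_bigr => i _.
rewrite dotqE; apply: eq_bigr => u _; congr (_ * _^*%R).
rewrite sum_perm_lift exchange_big /=; apply: eq_bigr => s _.
rewrite /level /lannih size_tuple big_mkord mulr_sumr; apply: eq_bigr => k _.
by rewrite inversions_lift tval_wact_lift exprD rmorphM /=; ring.
Qed.

Lemma qform0 q x y : qform q 0 x y = x [::] * (y [::])^*.
Proof.
have z (v : 0.-tuple 'I_d) : v = [::] :> seq _ by case: v => -[].
rewrite /qform dotqE (big_pred1 [tuple]) => [|v]; last first.
  by rewrite /= -val_eqE; case: v => -[].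
rewrite (big_pred1 1%g) => [|s]; last first.
  by rewrite /=; apply/esym/eqP/permP => -[].
rewrite /level (z (wact _ _)) /inversions (_ : finset _ = finset.set0) ?cards0 ?mul1r //.
by apply/setP => -[[]].
Qed.

Lemma qform_lcreate q n i x y : qform q n.+1 (lcreate i x) y = qform q n x (lannih q i y).
Proof.
rewrite qformS (bigD1 i) //= big1 ?addr0.
  by congr (qform q n _ _); apply/funext => w; rewrite mxE !eqxx mul1r.
move=> j ji; rewrite /qform /dotq /dot0 big1 // => w _.
rewrite /Pq big1 ?mul0r // => s _.
by rewrite /level /= mxE (negPf ji) andbF mul0r mulr0.
Qed.

(** A permutation and its inverse have equally many inversions. *)
Lemma qformC q n x y : qform q n y x = (qform q n x y)^*%R.
Proof.
rewrite /qform !dotqE rmorph_sum /=.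
under [RHS]eq_bigr do rewrite rmorphM /= conjCK mulr_sumr.
under eq_bigr do rewrite rmorph_sum mulr_sumr.
rewrite exchange_big [RHS]exchange_big /= (reindex_inj invg_inj) /=.
apply: eq_bigr => s _.
rewrite (reindex_inj (can_inj (wactK s))) /=; apply: eq_bigr => w _.
by rewrite wactK rmorphM /= conj_realc inversionsV; ring.
Qed.

Lemma qform_wrev q n x y : qform q n (wrev x) (wrev y) = qform q n x y.
Proof.
pose r : 'S_n := perm (@rev_ord_inj n).
have rr : (r * r = 1)%g by apply/permP => a; rewrite permM !permE rev_ordK.
have rE (w : n.-tuple 'I_d) : rev w = wact w r :> seq _.
  rewrite -[rev w]/(tval (rev_tuple w)); congr tval; apply: eq_from_tnth => a.
  have [x0 _] : exists x0 : 'I_d, true by exists (tnth w a).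
  by rewrite tnth_mktuple !(tnth_nth x0) /= nth_rev ?size_tuple // permE.
have wrK : involutive (fun w : n.-tuple 'I_d => wact w r).
  by move=> w; rewrite wactM rr; apply: eq_from_tnth => a; rewrite tnth_mktuple perm1.
rewrite /qform !dotqE (reindex_inj (inv_inj wrK)) /=; apply: eq_bigr => w _.
rewrite /level /wrev !rE wrK; congr (_ * _^*%R).
rewrite (reindex_inj (inj_comp (mulgI r) (mulIg r))); apply: eq_bigr => s _.
rewrite /comp mulgA inversions_rev !rE !wactM; congr (_ * y (wact w _)).
by rewrite !mulgA rr mul1g -mulgA rr mulg1.
Qed.

Lemma qform_rcreate q n i x y : qform q n.+1 (rcreate i x) y = qform q n x (rannih q i y).
Proof.
by rewrite -(wrevK y) /rcreate qform_wrev qform_lcreate /rannih wrevK -qform_wrev wrevK.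
Qed.

Lemma qformDl q n x x' y : qform q n (x + x') y = qform q n x y + qform q n x' y.
Proof.
by rewrite /qform !dotqE -big_split; apply: eq_bigr => w _; rewrite /level /= mulrDl.
Qed.

Lemma qformZl q n c x y : qform q n (c *: x) y = c * qform q n x y.
Proof. by rewrite /qform !dotqE mulr_sumr; apply: eq_bigr => w _; rewrite -mulrA. Qed.

Lemma qform_level q n x x' y y' : level n x = level n x' -> level n y = level n y' ->
  qform q n x y = qform q n x' y'.
Proof. by rewrite /qform => -> ->. Qed.

(* The kernel q^(number of pairs on which s and t disagree) is a product over
   pairs of the kernels (1 + q) / 2 + (1 - q) / 2 (+-1), whose characters do not
   depend on q.  Comparison with q = 0 makes positivity quantitative. *)
Lemma dotq_expansion n (x : tens d n) :
  exists N : {set 'I_n * 'I_n} -> C, (forall J, 0 <= N J) /\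
  forall q, n`!%:R * dotq q x x =
    \sum_(J : {set 'I_n * 'I_n})
      (\prod_(ab : 'I_n * 'I_n)
        (if ab \in J then (1 + q) / 2 else (1 - q) / 2))%:C * N J.
Proof.
pose sg (s : 'S_n) (ab : 'I_n * 'I_n) : C :=
  (-1) ^+ ((ab.1 < ab.2)%N && (s^-1%g ab.1 < s^-1%g ab.2)%N).
pose chi (J : {set 'I_n * 'I_n}) s : C := \prod_ab if ab \in J then 1 else sg s ab.
have chiJ J s : (chi J s)^*%R = chi J s.
  rewrite rmorph_prod; apply: eq_bigr => ab _; case: ifP => _; rewrite ?rmorph1 //.
  by rewrite rmorphXn rmorphN rmorph1.
pose S J w := \sum_s chi J s * x (wact w s).
exists (fun J => \sum_w S J w * (S J w)^*); split=> [J|q].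
  by apply: sumr_ge0 => w _; rewrite -normCK exprn_ge0.
pose al : R := (1 + q) / 2; pose be : R := (1 - q) / 2.
pose wt (J : {set 'I_n * 'I_n}) : R := \prod_ab if ab \in J then al else be.
(* The product over ordered pairs is expanded; [J] collects the pairs where the constant summand
   [al] is chosen. A pair not in increasing order contributes [al + be = 1]. *)
have KE (s t : 'S_n) : (q ^+ inversions (t * s^-1)%g)%:C =
    \sum_(J : {set 'I_n * 'I_n}) (wt J)%:C * (chi J s * chi J t).
  have -> : (q ^+ inversions (t * s^-1)%g)%:C =
      \prod_ab (al%:C + be%:C * (sg s ab * sg t ab)).
    rewrite -[t in LHS]invgK inversionsM -prodr_const rmorph_prod big_mkcond /=.
    apply: eq_bigr => ab _; rewrite /sg !inE.
    have e1 : al + be = 1 by rewrite /al /be; field.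
    have e2 : al - be = q by rewrite /al /be; field.
    case: (ab.1 < ab.2)%N => /=; last by rewrite !expr0 !mulr1 -rmorphD e1.
    case: (s^-1%g ab.1 < s^-1%g ab.2)%N; case: (t^-1%g ab.1 < t^-1%g ab.2)%N => /=;
      rewrite ?expr0 ?expr1 ?mulrNN ?mulr1 ?mul1r ?mulrN1 ?mulr1 -?rmorphN -?rmorphD ?e1 ?e2 //.
  rewrite bigA_distr; apply: eq_big => [J|J _]; first by rewrite inE.
  rewrite /wt rmorph_prod /chi -!big_split /=; apply: eq_bigr => ab _.
  by case: ifP => _; rewrite ?mulr1.
transitivity (\sum_s \sum_t \sum_w
    (q ^+ inversions (t * s^-1)%g)%:C * (x (wact w s) * (x (wact w t))^*)).
  rewrite -card_Sn -[RHS]/(\sum_(t in 'S_n) _) mulr_natl -sumr_const.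
  apply: eq_bigr => s _; rewrite dotqE.
  under eq_bigr do rewrite rmorph_sum mulr_sumr.
  rewrite exchange_big /= [RHS](reindex_inj (mulIg s)) /=; apply: eq_bigr => t _.
  rewrite mulgK [LHS](reindex_inj (can_inj (wactK s))) /=; apply: eq_bigr => w _.
  by rewrite wactM rmorphM /= conj_realc; ring.
under eq_bigr do under eq_bigr do rewrite KE -mulr_sumr mulr_suml.
under eq_bigr do rewrite exchange_big; rewrite exchange_big /=.
apply: eq_bigr => J _; rewrite mulr_sumr.
under [RHS]eq_bigr do rewrite rmorph_sum mulr_suml mulr_sumr.
rewrite [RHS]exchange_big /=; apply: eq_bigr => s _.
under [RHS]eq_bigr do rewrite mulr_sumr mulr_sumr.
rewrite [RHS]exchange_big /=; apply: eq_bigr => t _.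
rewrite mulr_sumr; apply: eq_bigr => w _.
by rewrite rmorphM /= chiJ -/(wt J); ring.
Qed.

Lemma qform_at0 n x y : qform 0 n x y = \sum_(v : n.-tuple 'I_d) x v * (y v)^*.
Proof.
elim: n x y => [|n IHn] x y.
  by rewrite qform0 (big_pred1 [tuple]) // => v; rewrite /= -val_eqE; case: v => -[].
rewrite qformS sum_tuple_cons; apply: eq_bigr => i _; rewrite IHn.
apply: eq_bigr => u _; rewrite /lannih big_nat_recl // insert_at0 expr0 mul1r.
by rewrite big1 ?addr0 // => k _; rewrite exprS mul0r mul0r.
Qed.

End Forms.

(** * Norm estimates on single levels *)

Section LevelBounds.
Context {R : realType}.
Variables (d : nat) (q : R) (q1 : -1 < q < 1).
Local Notation C := R[i].
Local Notation words := (@words R d).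
Implicit Types (x y : words) (i j : 'I_d) (n : nat).
Local Notation qform := (@qform R d q).
Local Notation qsqnorm := (@qsqnorm R d q).

Lemma normq_lt1 : `|q| < 1. Proof. by rewrite ltr_norml. Qed.

(** Two roles: its inverse bounds the squared norm of a creation operator, and it bounds below the
    ratio of the weight (1 + q) / 2 or (1 - q) / 2 of a pair to its value 1 / 2 at q = 0. *)
Definition gap : R := 1 - `|q|.

Lemma gap_gt0 : 0 < gap. Proof. by rewrite subr_gt0 normq_lt1. Qed.

(** The pair expansions at q and at 0 share the same nonnegative coefficients, so their weights can
    be compared factor by factor. The exponent [n * n] counts all ordered pairs. *)
Lemma qform_lower n x :
  (gap ^+ (n * n))%:C * \sum_(v : n.-tuple 'I_d) x v * (x v)^*%R <= qform n x x.
Proof.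
have [N [N0 NE]] := dotq_expansion (level n x).
rewrite -qform_at0 -(@ler_pM2l _ n`!%:R) ?ltr0n ?fact_gt0 // NE mulrCA [X in _ * X]NE.
rewrite mulr_sumr; apply: ler_sum => J _; rewrite mulrA -rmorphM /=.
apply: ler_wpM2r => //; rewrite lecR.
have -> : gap ^+ (n * n) = \prod_(ab : 'I_n * 'I_n) gap.
  by rewrite prodr_const card_prod !card_ord.
rewrite -big_split; apply: ler_prod => ab _ /=.
have := normq_lt1; have := ler_norm q; have := ler_norm (- q).
rewrite normrN /gap => h1 h2 h3.
by case: (ab \in J); apply/andP; split; lra.
Qed.

Lemma qform_psd n : psd_form (qform n).
Proof.
split=> [x y z|c x z|x y|x]; [exact: qformDl|exact: qformZl|exact: qformC|].
exact/dotq_ge0/ltW/normq_lt1.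
Qed.

Lemma qsqnormE n x : qsqnorm n x = rform (qform n) x x. Proof. by []. Qed.

Lemma qsqnorm_ge0 n x : 0 <= qsqnorm n x.
Proof. exact: rform_ge0 (qform_psd n) x. Qed.

Lemma coord_le_qsqnorm w x : gap ^+ (size w * size w) * cmod (x w) ^+ 2 <= qsqnorm (size w) x.
Proof.
rewrite -lecR [X in _ <= X%:C]qsqnormE -(rform_diag (qform_psd _)).
apply: le_trans (qform_lower (size w) x); rewrite rmorphM /=.
apply: ler_wpM2l; first by rewrite ler0c exprn_ge0 // ltW // gap_gt0.
rewrite (bigD1 (in_tuple w)) //= -cmod_sq lerDl.
by apply: sumr_ge0 => v _; rewrite -cmod_sq ler0c sqr_ge0.
Qed.

(** With z = l^* x, Cauchy-Schwarz gives |z|^4 = <l z, x>^2 <= |l z|^2 |x|^2. It is stated for a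
    single level so that the induction of [qsqnorm_lcreate] can call it. *)
Lemma qsqnorm_lannih_of_lcreate n i x :
  (forall y, qsqnorm n.+1 (lcreate i y) <= gap^-1 * qsqnorm n y) ->
  qsqnorm n (lannih q i x) <= gap^-1 * qsqnorm n.+1 x.
Proof.
move=> crb; set z := lannih q i x; have g0 := gap_gt0.
have [->|z0] := eqVneq (qsqnorm n z) 0.
  by rewrite mulr_ge0 ?qsqnorm_ge0 // invr_ge0 ltW.
have zp : 0 < qsqnorm n z by rewrite lt_def z0 qsqnorm_ge0.
have zE : rform (qform n.+1) (lcreate i z) x = qsqnorm n z by rewrite /rform qform_lcreate.
rewrite -(ler_pM2l zp) -expr2 -{1}zE.
apply: le_trans (cauchy_schwarz (qform_psd _) _ _) _.
by rewrite mulrCA mulrA; apply: ler_wpM2r; [exact: qsqnorm_ge0|exact: crb].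
Qed.

(* From l^* l = 1 + q l l^*, by induction on the level: if |l|^2 <= c below
   level n then |l|^2 <= 1 + |q| c on level n, and c = 1 / (1 - |q|) is the fixed
   point. *)
Lemma qsqnorm_lcreate n i x : qsqnorm n.+1 (lcreate i x) <= gap^-1 * qsqnorm n x.
Proof.
have g0 := gap_gt0; have gn1 : 1 <= gap^-1.
  by rewrite invf_ge1 // /gap gerBl.
have step m y : qsqnorm m.+1 (lcreate i y) =
    qsqnorm m y + q * rform (qform m) y (lcreate i (lannih q i y)).
  rewrite /qsqnorm qform_lcreate lannih_lcreate -/(rform _ y _) (rformDr (qform_psd m)).
  by rewrite (rformZr (qform_psd m)).
elim: n x => [|n IHn] x; rewrite step.
  rewrite /rform qform0 lcreate_nil rmorph0 mulr0 /= mulr0 addr0.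
  by rewrite ler_peMl // qsqnorm_ge0.
rewrite (rformC (qform_psd _)) /rform qform_lcreate -/(qsqnorm _ _); set z := lannih q i x.
have zx : qsqnorm n z <= gap^-1 * qsqnorm n.+1 x by exact: qsqnorm_lannih_of_lcreate.
apply: (@le_trans _ _ (qsqnorm n.+1 x + `|q| * (gap^-1 * qsqnorm n.+1 x))).
  rewrite lerD2l; apply: le_trans (ler_wpM2l _ zx) => //.
  by rewrite ler_wpM2r ?qsqnorm_ge0 // ler_norm.
rewrite mulrA -{1}[qsqnorm n.+1 x]mul1r -mulrDl; apply: ler_wpM2r; first exact: qsqnorm_ge0.
have e : gap + `|q| = 1 by rewrite /gap subrK.
by rewrite -[leRHS]mul1r -[1 in leRHS]e mulrDl divff // gt_eqF.
Qed.

Lemma qsqnorm_lannih n i x : qsqnorm n (lannih q i x) <= gap^-1 * qsqnorm n.+1 x.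
Proof. by apply: qsqnorm_lannih_of_lcreate => y; exact: qsqnorm_lcreate. Qed.

Lemma qsqnorm_wrev n x : qsqnorm n (wrev x) = qsqnorm n x.
Proof. by rewrite /qsqnorm qform_wrev. Qed.

Lemma qsqnorm_lcreate0 i x : qsqnorm 0 (lcreate i x) = 0.
Proof. by rewrite /qsqnorm qform0 mul0r. Qed.

Lemma qsqnorm_qnumber n x : qsqnorm n (qnumber q x) = (q ^+ n) ^+ 2 * qsqnorm n x.
Proof.
have -> : qsqnorm n (qnumber q x) = qsqnorm n ((q ^+ n)%:C *: x).
  congr complex.Re; apply: qform_level; apply/funext => w;
  by rewrite /level /qnumber size_tuple.
by rewrite !qsqnormE (rformZl (qform_psd n)) (rformZr (qform_psd n)) mulrA.
Qed.

End LevelBounds.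

Section Linearity.
Context {R : realType}.
Variables (d : nat) (q : R).
Implicit Types (x y : @words R d) (c : R[i]).

Lemma lcreate_linear i : linear (@lcreate R d i).
Proof.
move=> c x y; apply/funext => -[|j w]; rewrite !fctE /lcreate /= ?scaler0 ?addr0 //.
by rewrite mulrDr [in RHS]/GRing.scale /= mulrCA.
Qed.

Lemma lannih_linear i : linear (@lannih R d q i).
Proof.
move=> c x y; apply/funext => w; rewrite !fctE /lannih [_ *: _ in RHS]mulr_sumr -big_split.
by apply: eq_bigr => k _ /=; rewrite mulrDr [in LHS]/GRing.scale /= mulrCA.
Qed.

Lemma wrev_linear : linear (@wrev R d).
Proof. by move=> c x y; apply/funext => w. Qed.

Lemma qnumber_linear : linear (@qnumber R d q).
Proof.
move=> c x y; apply/funext => w; rewrite !fctE /qnumber.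
by rewrite mulrDr [in RHS]/GRing.scale /= mulrCA.
Qed.

End Linearity.

(** * Compact operators on Hilbert spaces *)

Section Spectral.
Local Open Scope classical_set_scope.
Context {R : realType} {V : lmodType R[i]}.
Local Notation C := R[i].
Variables (dot : V -> V -> C) (D : psd_form dot).
Hypothesis definite : forall x, dot x x = 0 -> x = 0.
Local Notation rf := (rform dot).
Local Notation hn := (hnorm dot).
Implicit Types (x y z v : V).

Lemma definite_hnorm x : hn x = 0 -> x = 0.
Proof. by move=> h; apply: definite; rewrite (rform_diag D) -(hnorm_sq D) h expr0n. Qed.

Lemma rform_ext x y : (forall v, rf x v = rf y v) -> x = y.
Proof.
move=> h; apply/eqP; rewrite -subr_eq0; apply/eqP/definite.
by rewrite (rform_diag D) (rformDl D) (rformNl D) h subrr.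
Qed.

Lemma rform_i x y : rf x ('i%C *: y) = complex.Im (dot x y).
Proof. by rewrite /rform (psdZr D); case: (dot x y) => a b /=; ring. Qed.

(** Real parts suffice: [v] may be replaced by i v, which tests the imaginary part by [rform_i]. *)
Definition weak_cvg (G : set_system nat) (u : nat -> V) y :=
  forall v, rf (u k) v @[k --> G] --> rf y v.

(* Passing to a filter G finer than [\oo] replaces passing to a subsequence. *)
Hypothesis weak_compact : forall (u : nat -> V) (M : R), (forall k, hn (u k) <= M) ->
  exists (G : set_system nat) (y : V), [/\ ProperFilter G, \oo `<=` G & weak_cvg G u y].

Lemma weak_dot G u y v c : ProperFilter G -> weak_cvg G u y ->
  (\forall k \near G, dot (u k) v = c) -> dot y v = c.
Proof.
move=> FG uy uc; apply/eqP; rewrite eq_complex; apply/andP; split; apply/eqP.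
  apply: (cvg_unique _ (uy v)) => //; apply: cvg_near_cst.
  by near=> k; rewrite /rform (near uc k).
rewrite -rform_i; apply: (cvg_unique _ (uy _)) => //; apply: cvg_near_cst.
by near=> k; rewrite rform_i (near uc k).
Unshelve. all: by end_near. Qed.

(** Testing against [y] itself: |y|^2 is the limit of <u_k, y>, hence at most M |y|. *)
Lemma weak_hnorm_le G u y (M : R) : ProperFilter G -> weak_cvg G u y ->
  (forall k, hn (u k) <= M) -> hn y <= M.
Proof.
move=> FG uy uM; have M0 : 0 <= M := le_trans (hnorm_ge0 _ _) (uM 0%N).
have [->//|y0] := eqVneq (hn y) 0.
have yp : 0 < hn y by rewrite lt_def y0 hnorm_ge0.
rewrite -(ler_pM2r yp) -expr2 (hnorm_sq D).
apply: (cvgr_to_le (uy y)); near=> k.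
apply: le_trans (ler_norm _) _; apply: le_trans (rform_le_hnorm D _ _) _.
by rewrite ler_wpM2r ?hnorm_ge0.
Unshelve. all: by end_near. Qed.

Variables (T S : V -> V).
Hypothesis linT : linear T.
Hypothesis adjS : forall x y, dot (S x) y = dot (T x) (T y).
Variables (Dn : nat -> nat) (eps : nat -> R).
Hypothesis Dn0 : Dn 0 = 0%N.
Hypothesis eps_cvg : eps @ \oo --> 0.
(* T is within [eps n] of an operator of rank at most [Dn n]. *)
Hypothesis approx : forall n, exists (K : R) (u : seq V), (size u <= Dn n)%N /\
  forall x, hn (T x) <= eps n * hn x + K * \sum_(v <- u) cmod (dot x v).

Let T0 : T 0 = 0 := lin0 linT.
Let TD x y : T (x + y) = T x + T y := linD linT x y.
Let TZ c x : T (c *: x) = c *: T x := linZ linT c x.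

Lemma opnorm_le x : hn (T x) <= eps 0%N * hn x.
Proof.
have [K [u [su h]]] := approx 0; move: su; rewrite Dn0 leqn0 => /nilP u0.
by have := h x; rewrite u0 big_nil mulr0 addr0.
Qed.

Lemma eps_small (r : R) : 0 < r -> exists n, eps n < r.
Proof.
move=> r0; have [n _ h] : \forall n \near \oo, eps n < r by exact: (cvgr_lt _ eps_cvg).
by exists n; exact: h (leqnn n).
Qed.

(** Compactness in the form used below: the finitely many functionals of [approx] tend to 0 by weak
    convergence, and the remainder is at most [eps n * M]. *)
Lemma cvg_T_weak_null (G : set_system nat) (z : nat -> V) (M : R) :
  ProperFilter G -> weak_cvg G z 0 -> (forall k, hn (z k) <= M) ->
  hn (T (z k)) @[k --> G] --> (0 : R).
Proof.
move=> FG z0 zM; have M0 : 0 <= M := le_trans (hnorm_ge0 _ _) (zM 0%N).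
have cm v : cmod (dot (z k) v) @[k --> G] --> (0 : R).
  have n0 v' : `|rf (z k) v'| @[k --> G] --> (0 : R).
    rewrite -[X in _ --> X](@normr0 _ R); apply: cvg_norm.
    by have := z0 v'; rewrite {2}/rform (psd0l D).
  have h : `|rf (z k) v| + `|rf (z k) ('i%C *: v)| @[k --> G] --> (0 : R).
    by rewrite -[X in _ --> X](addr0 (0 : R)); exact: cvgD.
  apply: (squeeze_cvgr _ (cvg_cst 0) h); near=> k.
  by rewrite cmod_ge0 rform_i cmod_le_ReIm.
have cs (u : seq V) : \sum_(v <- u) cmod (dot (z k) v) @[k --> G] --> (0 : R).
  elim: u => [|v u IHu].
    rewrite (_ : (fun k => _) = cst (0 : R)); first exact: cvg_cst.
    by apply/funext => k; rewrite big_nil.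
  rewrite (_ : (fun k => _) =
    (fun k => cmod (dot (z k) v) + \sum_(w <- u) cmod (dot (z k) w))).
    by rewrite -[X in _ --> X](addr0 (0 : R)); exact: cvgD.
  by apply/funext => k; rewrite big_cons.
apply/cvgr0Pnorm_lt => e e0; have [n ne] : exists n, eps n < e / 2 / (M + 1).
  by apply: eps_small; rewrite !divr_gt0 // ltr_wpDl.
have [K [u [_ h]]] := approx n.
have Ku : K * \sum_(v <- u) cmod (dot (z k) v) @[k --> G] --> (0 : R).
  by rewrite -[X in _ --> X](mulr0 K); exact: cvgMr (cs u).
near=> k; rewrite ger0_norm ?hnorm_ge0 //; apply: le_lt_trans (h _) _.
rewrite (splitr e); apply: ler_ltD.
  apply: (@le_trans _ _ (e / 2 / (M + 1) * hn (z k))).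
    by rewrite ler_wpM2r ?hnorm_ge0 // ltW.
  rewrite mulrAC ler_pdivrMr ?ltr_wpDl // ler_wpM2l ?divr_ge0 ?ltW //.
  by rewrite (le_lt_trans (zM k)) // ltrDl.
near: k; apply: (cvgr_lt _ Ku); exact: divr_gt0.
Unshelve. all: by end_near. Qed.

Let S_selfadj x y : dot (S x) y = dot x (S y).
Proof. by rewrite [RHS](psdC D) !adjS -(psdC D). Qed.

(* A weak limit y of a maximizing sequence for |T y| on the unit ball of the
   orthogonal W of E is a maximizer since T is compact; the form M <u, v> -
   <T u, T v> is then positive on W and vanishes at y. *)
Lemma exists_eigenvector (E : set V) (x : V) :
  (forall e, E e -> exists l : C, S e = l *: e) ->
  x <> 0 -> (forall e, E e -> dot x e = 0) ->
  exists y, [/\ dot y y = 1, forall e, E e -> dot y e = 0 &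
    exists l : C, S y = l *: y].
Proof.
move=> Eeig x0 xE; pose W := [set y | forall e, E e -> dot y e = 0].
have hx0 : 0 < hn x.
  by rewrite lt_def hnorm_ge0 andbT; apply/eqP => /definite_hnorm.
have WZ c y : W y -> W (c *: y) by move=> Wy e Ee; rewrite (psdZl D) Wy // mulr0.
have WD y z : W y -> W z -> W (y + z).
  by move=> Wy Wz e Ee; rewrite (psdDl D) Wy // Wz // addr0.
have WS y : W y -> W (S y).
  move=> Wy e Ee; have [l Sl] := Eeig _ Ee.
  by rewrite S_selfadj Sl (psdZr D) Wy // mulr0.
pose nx := (hn x)^-1%:C *: x.
have hnnx : hn nx = 1.
  by rewrite (hnormZ D) cmod_real ger0_norm ?invr_ge0 ?hnorm_ge0 // mulVf // gt_eqF.
have Wnx : W nx by exact: WZ.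
(* If T kills [nx] then so does S, and [nx] is an eigenvector. Otherwise the supremum [M] below is
   positive, which later forces |y| = 1. *)
have [Tx0|Tx0] := eqVneq (hn (T nx)) 0.
  exists nx; split=> //; first by rewrite (rform_diag D) -(hnorm_sq D) hnnx expr1n.
  exists 0; rewrite scale0r; apply: definite; rewrite adjS.
  by rewrite (definite_hnorm Tx0) (psd0l D).
pose A := [set hn (T y) ^+ 2 | y in [set y | W y /\ hn y <= 1]].
have Anx : A (hn (T nx) ^+ 2) by exists nx => //; split=> //; rewrite hnnx.
have Asup : has_sup A.
  split; first by exists (hn (T nx) ^+ 2).
  exists (eps 0%N ^+ 2) => _ [y [_ y1] <-].
  have e0 : 0 <= eps 0%N.
    by have := opnorm_le nx; rewrite hnnx mulr1; apply: le_trans; exact: hnorm_ge0.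
  rewrite lerXn2r ?nnegrE ?hnorm_ge0 //; apply: le_trans (opnorm_le y) _.
  by rewrite ler_piMr.
pose M := sup A.
have Mub y : W y -> hn (T y) ^+ 2 <= M * hn y ^+ 2.
  move=> Wy; have [y0|y0] := eqVneq (hn y) 0.
    by rewrite (definite_hnorm y0) T0 (hnorm0 D) expr0n mulr0.
  have yp : 0 < hn y by rewrite lt_def y0 hnorm_ge0.
  rewrite -ler_pdivrMr ?exprn_gt0 //; apply: (ub_le_sup (proj2 Asup)).
  exists ((hn y)^-1%:C *: y); last first.
    rewrite TZ (hnormZ D) cmod_real ger0_norm ?invr_ge0 ?hnorm_ge0 //.
    by rewrite exprMn exprVn mulrC.
  split; first exact: WZ.
  by rewrite (hnormZ D) cmod_real ger0_norm ?invr_ge0 ?hnorm_ge0 // mulVf.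
have Mp : 0 < M.
  apply: lt_le_trans (ub_le_sup (proj2 Asup) Anx).
  by rewrite exprn_gt0 // lt_def Tx0 hnorm_ge0.
have seqx k : exists y, [/\ W y, hn y <= 1 & M - k.+1%:R^-1 < hn (T y) ^+ 2].
  have k0 : 0 < k.+1%:R^-1 :> R by rewrite invr_gt0.
  have [_ [y [Wy y1] <-] h] := sup_adherent k0 Asup.
  by exists y.
have [u uP] := choice seqx.
have [G [y [FG sG uy]]] : exists (G : set_system nat) (y : V),
    [/\ ProperFilter G, \oo `<=` G & weak_cvg G u y].
  by apply: (weak_compact (M := 1)) => k; have [] := uP k.
have Wy : W y.
  move=> e Ee; apply: (weak_dot FG uy); near=> k.
  by have [+ _ _] := uP k; exact.
have hy1 : hn y <= 1 by apply: (weak_hnorm_le FG uy) => k; have [] := uP k.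
have zc : hn (T (u k - y)) @[k --> G] --> (0 : R).
  apply: (@cvg_T_weak_null _ _ 2) => // [v|k].
    rewrite /rform (psd0l D) /= -[X in _ --> X](subrr (rf y v)).
    rewrite (_ : (fun k => _) = (fun k => rf (u k) v - rf y v)).
      by apply: cvgB; [exact: uy|exact: cvg_cst].
    by apply/funext => k; rewrite (psdBl D) ReD ReN.
  apply: le_trans (hnormB D _ _) _; rewrite -[2]/(1 + 1) lerD //.
  by have [] := uP k.
have MT : M <= hn (T y) ^+ 2.
  have c1 : M - k.+1%:R^-1 @[k --> G] --> M.
    rewrite -[X in _ --> X]subr0; apply: cvgB; first exact: cvg_cst.
    by apply: cvg_trans (@cvg_harmonic R); exact: cvg_app.
  have c2 : (hn (T y) + hn (T (u k - y))) ^+ 2 @[k --> G] --> hn (T y) ^+ 2.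
    have c3 : hn (T y) + hn (T (u k - y)) @[k --> G] --> hn (T y).
      rewrite -[X in _ --> X](addr0 (hn (T y))).
      by apply: cvgD => //; exact: cvg_cst.
    by rewrite expr2; exact: cvgM.
  apply: (ler_cvg_to c1 c2); near=> k; have [_ _ h] := uP k.
  apply: le_trans (ltW h) _; rewrite lerXn2r ?nnegrE ?addr_ge0 ?hnorm_ge0 //.
  have -> : T (u k) = T y + T (u k - y) by rewrite -TD addrC subrK.
  exact: (hnormD D).
(* M <= |T y|^2 <= M |y|^2 with M > 0, so the weak limit has lost no norm. *)
have hy : hn y ^+ 2 = 1.
  apply/le_anti; rewrite expr_le1 ?hnorm_ge0 // hy1 /=.
  by rewrite -(ler_pM2l Mp) mulr1 (le_trans MT) // Mub.
have {}MT : hn (T y) ^+ 2 = M.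
  by apply/le_anti; rewrite MT andbT; have := Mub _ Wy; rewrite hy mulr1.
exists y; split=> //; first by rewrite (rform_diag D) -(hnorm_sq D) hy.
exists M%:C; apply/esym/eqP; rewrite -subr_eq0; apply/eqP/definite_hnorm.
set v := M%:C *: y - S y; pose a := rf v v; pose b := M * hn v ^+ 2 - hn (T v) ^+ 2.
have Wv : W v by apply: WD; [exact: WZ|rewrite -scaleN1r; exact/WZ/WS].
have a0 : 0 <= a := rform_ge0 D v.
have b0 : 0 <= b by rewrite subr_ge0 Mub.
have aE : a = M * rf y v - rf (T y) (T v).
  by rewrite /a {1}/v (rformDl D) (rformNl D) (rformZl D) /rform adjS.
clearbody v.
(* The value of M |.|^2 - |T .|^2 at y + t v: its constant term vanishes and its linear coefficient
   is 2 Re <M y - S y, v> = 2 |v|^2. *)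
have key (t : R) : 0 <= 2 * t * a + t ^+ 2 * b.
  have := Mub (y + t%:C *: v) (WD _ _ Wy (WZ _ _ Wv)).
  rewrite TD TZ !(hnorm_sq D) !(rformDl D, rformDr D, rformZl D, rformZr D) (rformC D v y).
  rewrite (rformC D (T v) (T y)) -!(hnorm_sq D) MT hy aE /b; lra.
have a_0 : a = 0.
  apply/le_anti; rewrite a0 andbT leNgt; apply/negP => ap.
  have bp : 0 < b + 1 by rewrite ltr_wpDl.
  (* Negative and small enough for the linear term to win; [b + 1] is positive even when b = 0. *)
  have := key (- a / (b + 1)).
  have -> : 2 * (- a / (b + 1)) * a + (- a / (b + 1)) ^+ 2 * b =
      - (a ^+ 2 * (b + 2) / (b + 1) ^+ 2).
    by field; rewrite gt_eqF.
  by rewrite oppr_ge0 leNgt divr_gt0 ?mulr_gt0 ?exprn_gt0 ?ltr_wpDl.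
by rewrite /hnorm -[complex.Re _]/a a_0 sqrtr0.
Unshelve. all: by end_near. Qed.

(** Zorn's lemma on orthonormal sets of eigenvectors: a vector orthogonal to a maximal one would
    yield a further eigenvector. The eigenvalue at e is <S e, e> = |T e|^2. *)
Lemma exists_eigenbasis : exists (I : choiceType) (e : I -> V),
  orthonormal_basis dot e /\ forall i, S (e i) = (hn (T (e i)) ^+ 2)%:C *: e i.
Proof.
pose P (E : set V) := (forall x y, E x -> E y -> dot x y = (x == y)%:R) /\
  forall x, E x -> exists l : C, S x = l *: x.
have [E [[Eon Eeig] Emax]] : exists E, P E /\ forall B, E `<` B -> ~ P B.
  apply: Zorn_bigcup => F FP Ftot; split.
    move=> x y [X FX Xx] [Y FY Yy]; have [XY|YX] := Ftot _ _ FX FY.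
      by have [+ _] := FP _ FY; apply=> //; exact: XY.
    by have [+ _] := FP _ FX; apply=> //; exact: YX.
  by move=> x [X FX Xx]; have [_ +] := FP _ FX; exact.
exists {x : V | `[< E x >]}, val; split; last first.
  move=> [x Ex'] /=; have Ex := asboolW Ex'; have [l Sl] := Eeig _ Ex.
  have xx : dot x x = 1 by rewrite Eon // eqxx.
  rewrite Sl; congr (_ *: _).
  by rewrite -[LHS]mulr1 -xx -(psdZl D) -Sl adjS (rform_diag D) (hnorm_sq D).
split=> [[x Ex] [y Ey]|x xE].
  by rewrite /= (Eon _ _ (asboolW Ex) (asboolW Ey)).
apply: contrapT => x0.
have [|y [yy yE [l Sl]]] := exists_eigenvector Eeig x0.
  by move=> e Ee; have := xE (exist _ e (asboolT Ee)).
have nEy : ~ E y.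
  by move=> Ey; have := yE _ Ey; rewrite yy => /eqP; rewrite oner_eq0.
apply: (Emax (E `|` [set y])).
  by split=> [|sub]; [exact: subsetUl|apply: nEy; apply: sub; right].
split=> [u v [Eu|->] [Ev|->]|u [Eu|->]];
  [exact: Eon| | |by rewrite yy eqxx|exact: Eeig|by exists l].
  rewrite (psdC D) yE // rmorph0; case: eqP => // uy.
  by exfalso; apply: nEy; rewrite -uy.
by rewrite yE //; case: eqP => // yv; exfalso; apply: nEy; rewrite yv.
Qed.

(** * Singular values and the absolute value in an eigenbasis *)

Section Eigenbasis.
Variables (I : choiceType) (e : I -> V) (s : I -> R).
Hypothesis e_basis : orthonormal_basis dot e.
Hypothesis s_ge0 : forall i, 0 <= s i.
Hypothesis S_eig : forall i, S (e i) = (s i ^+ 2)%:C *: e i.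

Let eon i j : dot (e i) (e j) = (i == j)%:R.
Proof. by case: e_basis. Qed.

Lemma basis_ext x y : (forall i, dot x (e i) = dot y (e i)) -> x = y.
Proof.
move=> h; apply/eqP; rewrite -subr_eq0; apply/eqP; apply: (proj2 e_basis) => i.
by rewrite (psdBl D) h subrr.
Qed.

Lemma dot_sum_basis (J : seq I) (c c' : I -> C) : uniq J ->
  dot (\sum_(i <- J) c i *: e i) (\sum_(i <- J) c' i *: e i) =
  \sum_(i <- J) c i * (c' i)^*%R.
Proof.
move=> uJ; rewrite (psd_suml D); apply: eq_big_seq => i iJ.
rewrite (psdZl D) (psd_sumr D) (bigD1_seq i) //= (psdZr D) eon eqxx mulr1.
rewrite big1 ?addr0 // => j ji.
by rewrite (psdZr D) eon eq_sym (negPf ji) mulr0.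
Qed.

Lemma hnorm_sum_basis (J : seq I) (c : I -> C) : uniq J ->
  hn (\sum_(i <- J) c i *: e i) ^+ 2 = \sum_(i <- J) cmod (c i) ^+ 2.
Proof.
move=> uJ; apply: complexI; rewrite (hnorm_sq D) -(rform_diag D) dot_sum_basis //.
by rewrite rmorph_sum; apply: eq_bigr => i _; rewrite /= cmod_sq.
Qed.

Lemma hnorm_T_sum_basis (J : seq I) (c : I -> C) : uniq J ->
  hn (T (\sum_(i <- J) c i *: e i)) ^+ 2 = \sum_(i <- J) s i ^+ 2 * cmod (c i) ^+ 2.
Proof.
move=> uJ; apply: complexI; rewrite (hnorm_sq D) -(rform_diag D) -adjS S_selfadj.
have SL : S (\sum_(i <- J) c i *: e i) = \sum_(i <- J) ((s i ^+ 2)%:C * c i) *: e i.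
  apply: basis_ext => j; rewrite S_selfadj S_eig (psdZr D) !(psd_suml D) mulr_sumr.
  apply: eq_bigr => i _; rewrite !(psdZl D) eon conj_realc.
  by case: eqP => [->|_]; rewrite ?mulr0 // !mulr1.
rewrite SL dot_sum_basis // rmorph_sum; apply: eq_bigr => i _.
by rewrite [RHS](rmorphM (real_complex R)) /= cmod_sq rmorphM /= conj_realc; ring.
Qed.

Lemma sE i : s i = hn (T (e i)).
Proof.
have := @hnorm_T_sum_basis [:: i] (fun=> 1) isT.
rewrite !big_seq1 scale1r (cmod_real 1) normr1 expr1n mulr1 => h.
by apply/eqP; rewrite -(eqrXn2 (n := 2)) ?hnorm_ge0 ?s_ge0 // h.
Qed.

Lemma s_le i : s i <= eps 0%N.
Proof.
rewrite sE; apply: le_trans (opnorm_le _) _.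
suff -> : hn (e i) = 1 by rewrite mulr1.
by rewrite /hnorm eon eqxx /= sqrtr1.
Qed.

Hypothesis eps_ge0 : forall n, 0 <= eps n.

(* More than [Dn n] such vectors would span a nonzero vector killed by all the
   functionals of [approx], on which |T v| <= eps n |v|. *)
Lemma count_large (J : seq I) n : uniq J -> (forall i, i \in J -> eps n < s i) ->
  (size J <= Dn n)%N.
Proof.
move=> uJ Js; have [K [u [su Tu]]] := approx n; apply: leq_trans su.
rewrite leqNgt; apply/negP => uJs.
have [i0 i0J] : exists i0, i0 \in J.
  by case: J uJs {uJ Js} => // i J _; exists i; rewrite mem_head.
pose A : 'M[C]_(size J, size u) := \matrix_(a, b) dot (e (nth i0 J a)) (nth 0 u b).
(* [A] has more rows than columns, so some nonzero combination of the [e i] is orthogonal to all of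
   [u]. *)
have [r /sub_kermxP rA ka] : exists2 r : 'rV_(size J), (r <= kermx A)%MS & r != 0.
  apply/rowV0Pn; rewrite kermx_eq0; apply: contraL uJs => /eqP <-.
  by rewrite -leqNgt rank_leq_col.
pose c i : C := oapp (fun k => r 0 k) 0 (insub (index i J)).
have cE (k : 'I_(size J)) : c (nth i0 J k) = r 0 k.
  by rewrite /c index_uniq // valK.
pose v := \sum_(i <- J) c i *: e i.
have vu w : w \in u -> dot v w = 0.
  move=> wu; rewrite /v (psd_suml D) (big_nth i0) big_mkord.
  have := congr1 (fun M : 'rV_(size u) => M 0 (Ordinal (etrans (index_mem w u) wu))) rA.
  rewrite mxE [X in _ = X -> _]mxE => h; rewrite -[RHS]h; apply: eq_bigr => k _.
  by rewrite (psdZl D) cE mxE /= nth_index.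
have [i1 i1J ci1] : exists2 i, i \in J & c i != 0.
  have /rV0Pn[k rk] := ka; exists (nth i0 J k); first by rewrite mem_nth.
  by rewrite cE.
have : hn (T v) ^+ 2 <= eps n ^+ 2 * hn v ^+ 2.
  rewrite -exprMn lerXn2r ?nnegrE ?mulr_ge0 ?hnorm_ge0 //.
  apply: le_trans (Tu v) _; rewrite big1_seq ?mulr0 ?addr0 // => w /andP[_ wu].
  by rewrite vu // cmod0.
apply/negP; rewrite -ltNge hnorm_T_sum_basis // hnorm_sum_basis // mulr_sumr.
have lts i : i \in J -> eps n ^+ 2 < s i ^+ 2.
  by move=> iJ; rewrite ltrXn2r ?nnegrE // Js.
rewrite (bigD1_seq i1) //= [ltRHS](bigD1_seq i1) //=; apply: ltr_leD.
  rewrite ltr_pM2r ?lts // exprn_gt0 // lt_def cmod_ge0 andbT.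
  by apply: contra ci1 => /eqP/cmod_eq0 ->.
rewrite big_seq_cond [leRHS]big_seq_cond; apply: ler_sum => i /andP[iJ _].
by rewrite ler_wpM2r ?sqr_ge0 // ltW // lts.
Qed.

Lemma finite_large n : finite_set [set i | eps n < s i].
Proof.
apply: contrapT => /infinite_set_fsetP/(_ (Dn n).+1)[B Bs].
apply/negP; rewrite -leqNgt; apply: count_large; first exact: fset_uniq.
by move=> i iB; exact: Bs.
Qed.

Lemma dot_coef (J : seq I) (c : I -> C) j : uniq J ->
  dot (\sum_(i <- J) c i *: e i) (e j) = (j \in J)%:R * c j.
Proof.
move=> uJ; rewrite (psd_suml D); have [jJ|jJ] := boolP (j \in J).
  rewrite (bigD1_seq j) //= (psdZl D) eon eqxx mulr1 big1 ?addr0 ?mul1r // => i ij.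
  by rewrite (psdZl D) eon (negPf ij) mulr0.
rewrite mul0r big1_seq // => i /andP[_ iJ]; rewrite (psdZl D) eon.
by case: eqP => [ij|_]; [rewrite ij in iJ; rewrite iJ in jJ|rewrite mulr0].
Qed.

Lemma bessel (J : seq I) x : uniq J ->
  \sum_(i <- J) cmod (dot x (e i)) ^+ 2 <= hn x ^+ 2.
Proof.
move=> uJ; pose y := \sum_(i <- J) dot x (e i) *: e i.
have xy : rf x y = \sum_(i <- J) cmod (dot x (e i)) ^+ 2.
  rewrite /rform (psd_sumr D) Re_sum; apply: eq_bigr => i _.
  by rewrite (psdZr D) mulrC -cmod_sq.
have := rform_ge0 D (x - y).
rewrite !(rformDl D, rformDr D, rformNl D, rformNr D) (rformC D y x) -!(hnorm_sq D).
by rewrite hnorm_sum_basis // xy; lra.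
Qed.

(** The vector |T| x is a weak limit of the sums over the finite sets [F n], bounded by Bessel's
    inequality; positivity passes to the limit. *)
Lemma diag_vector x : exists y, [/\ forall i, dot y (e i) = (s i)%:C * dot x (e i),
  hn y <= eps 0%N * hn x & 0 <= dot y x].
Proof.
pose F n : seq I := fset_set [set i | eps n < s i].
have uF n : uniq (F n) by exact: fset_uniq.
pose u n := \sum_(i <- F n) ((s i)%:C * dot x (e i)) *: e i.
have ux n : dot (u n) x = (\sum_(i <- F n) s i * cmod (dot x (e i)) ^+ 2)%:C.
  rewrite (psd_suml D) rmorph_sum; apply: eq_bigr => i _.
  rewrite (psdZl D) [dot (e i) x](psdC D) -mulrA -cmod_sq.
  by rewrite [RHS](rmorphM (real_complex R)).
have uM n : hn (u n) <= eps 0%N * hn x.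
  rewrite -ler_sqr ?nnegrE ?mulr_ge0 ?hnorm_ge0 // exprMn.
  apply: le_trans (ler_wpM2l (sqr_ge0 _) (bessel x (uF n))).
  rewrite hnorm_sum_basis // mulr_sumr; apply: ler_sum => i _.
  rewrite cmodM cmod_real ger0_norm // exprMn ler_wpM2r ?sqr_ge0 //.
  by rewrite lerXn2r ?nnegrE // s_le.
have [G [y [FG sG uy]]] := weak_compact uM.
exists y; split; last 2 first.
- exact: weak_hnorm_le FG uy uM.
- rewrite lecE; apply/andP; split.
    apply/eqP; rewrite -rform_i; apply: (cvg_unique _ (uy _)) => //.
    by apply: cvg_near_cst; near=> k; rewrite rform_i ux.
  apply: (cvgr_to_ge (uy x)); near=> k.
  by rewrite /rform ux /= sumr_ge0 // => i _; rewrite mulr_ge0 ?sqr_ge0.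
move=> j; apply: (weak_dot FG uy); apply: sG.
(* An index with [s j = 0] lies in no [F k], but then both sides are 0; any other index lies in
   [F k] eventually. *)
have [sj|sj] := eqVneq (s j) 0.
  by near=> k; rewrite dot_coef // sj !mul0r mulr0.
have sj0 : 0 < s j by rewrite lt_def sj s_ge0.
near=> k; rewrite dot_coef //.
have -> : j \in F k; last by rewrite mul1r.
rewrite in_fset_set; last exact: finite_large.
apply/mem_set => /=; near: k; exact: (cvgr_lt _ eps_cvg).
Unshelve. all: by end_near. Qed.

(** Vectors are picked one by one by [choice]; linearity follows because coefficients in the basis
    determine a vector. *)
Lemma is_abs_diag : exists A : V -> V, is_abs dot T A /\
  forall i, A (e i) = (s i)%:C *: e i.
Proof.
have [A AP] := choice diag_vector.
have Ae x i : dot (A x) (e i) = (s i)%:C * dot x (e i) by have [] := AP x.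
exists A; split=> [|i]; last first.
  apply: basis_ext => j; rewrite Ae (psdZl D) eon.
  by case: eqP => [->|_]; rewrite ?mulr0.
split=> [|x|x y]; last 2 first.
- by have [] := AP x.
- rewrite -adjS; congr (dot _ y); apply: basis_ext => i.
  by rewrite !Ae S_selfadj S_eig (psdZr D) conj_realc expr2 rmorphM mulrA.
split=> [c x y|]; last by exists (eps 0%N) => x; have [] := AP x.
apply: basis_ext => i; rewrite (psdDl D) (psdZl D) !Ae (psdDl D) (psdZl D); ring.
Qed.

(** If [m.+1] is the least index with [eps m.+1 < s i], then [s i <= eps m], so the term of index
    [m] alone dominates. The least index is not 0 by [s_le]. *)
Lemma powR_s_le (r : R) i : 0 < r -> exists N0, forall N, (N0 <= N)%N ->
  s i `^ r <= \sum_(n < N) (eps n.+1 < s i)%R%:R * eps n `^ r.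
Proof.
move=> r0; have t0 n : 0 <= (eps n.+1 < s i)%R%:R * eps n `^ r :> R.
  by rewrite mulr_ge0 ?powR_ge0.
have [si|si] := eqVneq (s i) 0.
  by exists 0%N => N _; rewrite {1}si powR0 ?gt_eqF // sumr_ge0.
have sp : 0 < s i by rewrite lt_def si s_ge0.
have ex := eps_small sp; case: (ex_minnP ex) => [[|m] em mmin].
  by move: em; rewrite ltNge s_le.
exists m.+1 => N mN; rewrite (bigD1 (Ordinal mN)) //= em mul1r.
apply: (@le_trans _ _ (eps m `^ r)); last by rewrite lerDl sumr_ge0.
apply: ge0_ler_powR; rewrite ?nnegrE ?s_ge0 ?(ltW r0) //.
by rewrite leNgt; apply/negP => /mmin; rewrite ltnn.
Qed.

(** Exchanging the sums leaves, for each [n], the number of indices with [eps n.+1 < s i], which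
    [count_large] bounds by [Dn n.+1]. *)
Lemma sum_powR_le (r B : R) (J : seq I) : 0 < r -> uniq J ->
  (forall N, \sum_(n < N) (Dn n.+1)%:R * eps n `^ r <= B) ->
  \sum_(i <- J) s i `^ r <= B.
Proof.
move=> r0 uJ hB; have [N0 hN0] := choice (fun i => powR_s_le i r0).
pose N := (\max_(i <- J) N0 i)%N; apply: le_trans (hB N).
apply: (@le_trans _ _ (\sum_(i <- J) \sum_(n < N) (eps n.+1 < s i)%R%:R * eps n `^ r)).
  rewrite big_seq [leRHS]big_seq; apply: ler_sum => i iJ; apply: hN0.
  by rewrite /N; apply: leq_bigmax_seq.
rewrite exchange_big /=; apply: ler_sum => n _; rewrite -mulr_suml.
rewrite ler_wpM2r ?powR_ge0 // -natr_sum ler_nat.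
rewrite -[X in (X <= _)%N](_ : size [seq i <- J | eps n.+1 < s i] = _); last first.
  by rewrite size_filter -sum1_count big_mkcond; apply: eq_bigr => i _; case: ifP.
apply: count_large; first by rewrite filter_uniq.
by move=> i; rewrite mem_filter => /andP[].
Qed.

End Eigenbasis.

Lemma schatten_of_approx (p : \bar R) : (forall n, 0 <= eps n) -> (0 < p)%E ->
  (forall r, p = r%:E -> exists B, forall N,
     \sum_(n < N) (Dn n.+1)%:R * eps n `^ r <= B) ->
  schatten dot p T.
Proof.
move=> eps0 p0 pB; split; first by split=> //; exists (eps 0%N); exact: opnorm_le.
have [I [e [be Se]]] := exists_eigenbasis.
have s0 i : 0 <= hn (T (e i)) by exact: hnorm_ge0.
have [A [absA Ae]] := is_abs_diag be s0 Se eps0.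
exists A, I, e, (fun i => hn (T (e i))); split=> //.
case: p p0 pB => [r r0 /(_ r erefl)[B hB]|_ _ r r0|//]; last first.
  have [n nr] := eps_small r0.
  apply: (sub_finite_set _ (finite_large be Se eps0 n)).
  by move=> i /=; apply: lt_trans.
apply: (@le_lt_trans _ _ B%:E); last exact: ltry.
apply: ge_ereal_sup => _ [J [finJ _] <-].
rewrite fsbig_finite //= sumEFin lee_fin.
exact: (sum_powR_le be s0 Se eps0).
Qed.

End Spectral.

(** * The q-Fock space *)

(** The image filter has a cluster point in a compact segment, and an ultrafilter converges to each
    of its cluster points. *)
Lemma ultra_bounded_cvg (R : realType) (T : Type) (G : set_system T) (f : T -> R) (B : R) :
  UltraFilter G -> (forall k, `|f k| <= B) -> exists l : R, (f k @[k --> G] --> l)%classic.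
Proof.
move=> UG fB; have FG : ProperFilter G by exact: ultra_proper.
have /(_ (f @ G)%classic)[|p [_ pc]] := @segment_compact R (- B) B.
  change (G (f @^-1` `[- B, B])%classic).
  by apply: filterS filterT => k _; rewrite /= in_itv /= -ler_norml fB.
exists p => A Ap; have [//|nA] := in_ultra_setVsetC (f @^-1` A)%classic UG.
by have [x [nx Ax]] := pc (~` A)%classic A nA Ap.
Unshelve. all: by end_near. Qed.

Section Fock.
Local Open Scope classical_set_scope.
Context {R : realType}.
Variables (d : nat) (q : R) (q1 : -1 < q < 1).
Local Notation C := R[i].
Local Notation words := (@words R d).
Local Notation F := (@qFock R d q q1).
Local Notation qsqnorm := (@qsqnorm R d q).
Local Notation rqform n x y := (rform (@qform R d q n) (x : words) (y : words)).

Lemma Fval_inj (x y : F) : x = y :> words -> x = y.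
Proof. exact: val_inj. Qed.

Lemma sum_qsqnorm_ge0 (x : words) K : 0 <= \sum_(0 <= n < K) qsqnorm n x.
Proof. by apply: sumr_ge0 => n _; exact: qsqnorm_ge0. Qed.

Lemma summable_of_bound (x : words) (B : R) :
  (forall K, \sum_(0 <= n < K) qsqnorm n x <= B) -> x \in square_summable q.
Proof.
move=> xB; apply/asboolP/nondecreasing_is_cvgn.
  by apply: nondecreasing_series => n _ _; exact: qsqnorm_ge0.
by exists B => _ [K _ <-]; exact: xB.
Qed.

Lemma F_cvg (x : F) : cvgn (series (fun n => qsqnorm n x)).
Proof. by case: x => x /= /asboolP. Qed.

Lemma cvg_dqr (x y : F) : cvgn (series (fun n => rqform n x y)).
Proof.
apply: normed_cvg; apply: (@series_le_cvg _ _ (fun n => qsqnorm n x + qsqnorm n y)) => [n|n|n|].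
- exact: normr_ge0.
- by rewrite addr_ge0 ?qsqnorm_ge0.
- apply: le_trans (rform_le_hnorm (qform_psd d q1 n) _ _) _.
  rewrite !qsqnormE -!(hnorm_sq (qform_psd d q1 n)); move: (hnorm _ _) (hnorm _ _) => a b.
  have := sqr_ge0 (a - b); have := sqr_ge0 a; have := sqr_ge0 b; nra.
by apply: is_cvg_seriesD; exact: F_cvg.
Qed.

Definition qre (x y : F) : R := limn (series (fun n => rqform n x y)).

(** Conjugate linearity in [y] turns the imaginary part into a real part, so every statement on
    [qdot] reduces to one real series. *)
Lemma qreE (x y : F) : qdot x y = qre x y +i* qre x ('i%C *: y).
Proof.
rewrite /qdot /qre; congr (_ +i* limn (series _)).
by apply/funext => n; rewrite [RHS](rform_i (qform_psd d q1 n)).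
Qed.

Lemma qreDl x y z : qre (x + y) z = qre x z + qre y z.
Proof.
rewrite /qre -lim_seriesD; [|exact: cvg_dqr|exact: cvg_dqr].
by congr (limn (series _)); apply/funext => n; rewrite [LHS](rformDl (qform_psd d q1 n)).
Qed.

Lemma qreZl (a : R) x z : qre (a%:C *: x) z = a * qre x z.
Proof.
rewrite /qre -[RHS]/(a *: limn _) -lim_seriesZ; last exact: cvg_dqr.
by congr (limn (series _)); apply/funext => n; rewrite [LHS](rformZl (qform_psd d q1 n)).
Qed.

Lemma qreC x y : qre y x = qre x y.
Proof.
by congr (limn (series _)); apply/funext => n; rewrite [LHS](rformC (qform_psd d q1 n)).
Qed.

Lemma qre_i x y : qre ('i%C *: x) y = - qre x ('i%C *: y).
Proof.
rewrite /qre -lim_seriesN; last exact: cvg_dqr.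
congr (limn (series _)); apply/funext => n; rewrite fctE.
rewrite [X in - X](rform_i (qform_psd d q1 n)) /rform [in LHS](psdZl (qform_psd d q1 n)).
by case: (qform _ _ _ _) => a b /=; ring.
Qed.

Lemma qre_ii x y : qre ('i%C *: x) ('i%C *: y) = qre x y.
Proof.
congr (limn (series _)); apply/funext => n.
rewrite [LHS](rform_i (qform_psd d q1 n)) [qform _ _ _ _](psdZl (qform_psd d q1 n)) /rform.
by case: (qform _ _ _ _) => a b /=; ring.
Qed.

Lemma sum_qsqnorm_le (x : F) K : \sum_(0 <= n < K) qsqnorm n x <= qre x x.
Proof.
apply: (nondecreasing_cvgn_le _ (@F_cvg x) K).
by apply: nondecreasing_series => n _ _; exact: qsqnorm_ge0.
Qed.

Lemma qre_le (x : F) (B : R) : (forall K, \sum_(0 <= n < K) qsqnorm n x <= B) -> qre x x <= B.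
Proof.
by move=> xB; apply: limr_le; [exact: F_cvg|near=> K; exact: xB].
Unshelve. all: by end_near. Qed.

Lemma qdot_psd : psd_form (@qdot R d q q1).
Proof.
have dec (c : C) (x : F) : c *: x = (complex.Re c)%:C *: x + (complex.Im c)%:C *: ('i%C *: x).
  by rewrite scalerA -scalerDl [in LHS](complexE c) ['i%C * _]mulrC.
split=> [x y z|c x z|x y|x].
- by rewrite !qreE !qreDl; apply/eqP; rewrite eq_complex /= !eqxx.
- rewrite dec !qreE !qreDl !qreZl qre_ii qre_i.
  by case: c => a b; apply/eqP; rewrite eq_complex /=; apply/andP; split; apply/eqP; ring.
- by rewrite !qreE (qreC x y) -[qre y ('i%C *: x)]qreC qre_i.
- rewrite qreE lecE /=; apply/andP; split.
    have := qre_i x x; rewrite qreC => /eqP; rewrite -addr_eq0 -mulr2n mulrn_eq0 /=.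
    by move=> /eqP ->.
  by apply: le_trans (sum_qsqnorm_ge0 x 0) (sum_qsqnorm_le x 0).
Qed.

Local Notation D := qdot_psd.
Local Notation dot := (@qdot R d q q1).
Local Notation hn := (hnorm dot).
Local Notation rf := (rform dot).

Lemma rform_qre x y : rf x y = qre x y.
Proof. by rewrite /rform qreE. Qed.

Lemma sum_qsqnorm_le_hnorm (x : F) K : \sum_(0 <= n < K) qsqnorm n x <= hn x ^+ 2.
Proof. by rewrite (hnorm_sq D) rform_qre; exact: sum_qsqnorm_le. Qed.

Lemma hnorm_le_bound (x : F) (B : R) : (forall K, \sum_(0 <= n < K) qsqnorm n x <= B) ->
  hn x ^+ 2 <= B.
Proof. by rewrite (hnorm_sq D) rform_qre; exact: qre_le. Qed.

Lemma coord_le_hnorm (x : F) w :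
  gap q ^+ (size w * size w) * cmod ((x : words) w) ^+ 2 <= hn x ^+ 2.
Proof.
apply: le_trans (coord_le_qsqnorm q1 w x) _; apply: le_trans (sum_qsqnorm_le_hnorm x (size w).+1).
by rewrite big_nat_recr //= lerDr sum_qsqnorm_ge0.
Qed.

Lemma qdot_definite (x : F) : dot x x = 0 -> x = 0.
Proof.
move=> xx; apply: Fval_inj; apply/funext => w.
apply: cmod_eq0; apply/eqP; rewrite -sqrf_eq0.
have g0 : 0 < gap q ^+ (size w * size w) by rewrite exprn_gt0 // gap_gt0.
rewrite eq_le sqr_ge0 andbT -(ler_pM2l g0) mulr0.
by apply: le_trans (coord_le_hnorm x w) _; rewrite (hnorm_sq D) /rform xx.
Qed.

Definition trunc_words K (x : words) : words := fun w => if (size w < K)%N then x w else 0.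

Lemma qform_trunc n K x y :
  qform q n (trunc_words K x) y = if (n < K)%N then qform q n x y else 0.
Proof.
case: ifPn => nK.
  by apply: qform_level => //; apply/funext => w; rewrite /level /trunc_words size_tuple nK.
rewrite -(psd0l (qform_psd d q1 n) y); apply: qform_level => //; apply/funext => w.
by rewrite /level /trunc_words size_tuple (negPf nK).
Qed.

Lemma qsqnorm_trunc n K x : qsqnorm n (trunc_words K x) = if (n < K)%N then qsqnorm n x else 0.
Proof.
rewrite qsqnormE /rform qform_trunc; case: ifP => // nK.
by rewrite (qformC q n (trunc_words K x) x) qform_trunc nK -qformC.
Qed.

Lemma sum_qsqnorm_trunc N K x :
  \sum_(0 <= n < N) qsqnorm n (trunc_words K x) = \sum_(0 <= n < minn N K) qsqnorm n x.
Proof.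
under eq_bigr do rewrite qsqnorm_trunc; rewrite -big_mkcond /=.
rewrite [RHS](big_nat_widen _ _ N) ?geq_minl // big_nat_cond [RHS]big_nat_cond.
by apply: eq_bigl => n; rewrite /= leq_min; case: (n < N)%N; case: (n < K)%N.
Qed.

Lemma trunc_summable K x : trunc_words K x \in square_summable q.
Proof.
apply: (@summable_of_bound _ (\sum_(0 <= n < K) qsqnorm n x)) => N; rewrite sum_qsqnorm_trunc.
rewrite [leRHS](@big_cat_nat _ _ _ (minn N K)) ?geq_minr //= lerDl.
by apply: sumr_ge0 => n _; exact: qsqnorm_ge0.
Qed.

(** Defined on all families, since [qFock_weak_compact] truncates a limit whose summability is not
    yet known. *)
Definition trunc K (x : words) : F := QFock q1 (trunc_summable K x).

Lemma rform_trunc K (x : F) (y : words) : rf x (trunc K y) = \sum_(0 <= n < K) rqform n x y.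
Proof.
rewrite rform_qre -qreC /qre; apply/(@cvg_lim _ _ _ _ _ _ _) => //.
apply: cvg_near_cst; near=> N; rewrite /series /=.
have KN : (K <= N)%N by near: N; exact: nbhs_infty_ge.
rewrite (@big_cat_nat _ _ _ K) //= [X in _ + X]big1_seq ?addr0 => [|n /andP[_]].
  apply: eq_big_nat => n /andP[_ nK].
  by rewrite /rform qform_trunc nK -[LHS](rformC (qform_psd d q1 n)).
rewrite mem_index_iota => /andP[Kn _].
by rewrite /rform qform_trunc ltnNge Kn.
Unshelve. all: by end_near. Qed.

Lemma hnorm_trunc K (y : words) : hn (trunc K y) ^+ 2 = \sum_(0 <= n < K) qsqnorm n y.
Proof.
rewrite (hnorm_sq D) rform_trunc; apply: eq_big_nat => n /andP[_ nK].
by rewrite /rform qform_trunc nK.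
Qed.

Lemma hnorm_sub_trunc_sq (x : F) K :
  hn (x - trunc K x) ^+ 2 = hn x ^+ 2 - \sum_(0 <= n < K) qsqnorm n x.
Proof.
rewrite (hnorm_sq D) !(rformDl D, rformDr D, rformNl D, rformNr D).
rewrite -(hnorm_sq D) -(hnorm_sq D (trunc K x)).
have e : rf x (trunc K x) = hn (trunc K x) ^+ 2 by rewrite rform_trunc hnorm_trunc.
by rewrite (rformC D (trunc K x)) e hnorm_trunc; ring.
Qed.

Lemma hnorm_sub_trunc (x : F) : hn (x - trunc K x) @[K --> \oo] --> (0 : R).
Proof.
have c0 : hn (x - trunc K x) ^+ 2 @[K --> \oo] --> (0 : R).
  rewrite (_ : (fun K => _) = (fun K => hn x ^+ 2 - \sum_(0 <= n < K) qsqnorm n x)); last first.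
    by apply/funext => K; exact: hnorm_sub_trunc_sq.
  rewrite -[X in _ --> X](subrr (hn x ^+ 2)); apply: cvgB; first exact: cvg_cst.
  by rewrite (hnorm_sq D) rform_qre; exact: F_cvg.
apply/cvgr0Pnorm_lt => e e0; near=> K; rewrite ger0_norm ?hnorm_ge0 //.
rewrite -ltr_sqr ?nnegrE ?hnorm_ge0 ?ltW //; near: K.
by apply: (cvgr_lt _ c0); rewrite exprn_gt0.
Unshelve. all: by end_near. Qed.

Lemma cvg_dqr_coord (G : set_system nat) (z : nat -> words) n (v : words) :
  ProperFilter G -> (forall w, cmod (z k w) @[k --> G] --> (0 : R)) ->
  rqform n (z k) v @[k --> G] --> (0 : R).
Proof.
move=> FG z0; pose c (w : n.-tuple 'I_d) : C :=
  (\sum_(s : 'S_n) (q ^+ inversions s)%:C * level n v (wact w s))^*%R.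
have h : \sum_(w : n.-tuple 'I_d) cmod (z k w) * cmod (c w) @[k --> G] --> (0 : R).
  rewrite -[X in _ --> X](_ : \sum_(w : n.-tuple 'I_d) 0 * cmod (c w) = _); last first.
    by rewrite big1 // => w _; rewrite mul0r.
  by apply: (@cvg_big _ _ _ _ _ _ _ _ _ _ _ _) => [|w _]; [exact: add_continuous|apply: cvgMl].
apply/cvgr0Pnorm_lt => e e0; near=> k.
apply: (@le_lt_trans _ _ (\sum_(w : n.-tuple 'I_d) cmod (z k w) * cmod (c w))).
  rewrite /rform /qform dotqE Re_sum; apply: le_trans (ler_norm_sum _ _ _) _.
  by apply: ler_sum => w _; rewrite -cmodM cmod_ge_Re.
near: k; exact: (cvgr_lt _ h).
Unshelve. all: by end_near. Qed.

(* Take coordinatewise limits along an ultrafilter. *)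
Lemma qFock_weak_compact (u : nat -> F) (M : R) : (forall k, hn (u k) <= M) ->
  exists (G : set_system nat) (y : F), [/\ ProperFilter G, \oo `<=` G & weak_cvg dot G u y].
Proof.
move=> uM; have M0 : 0 <= M := le_trans (hnorm_ge0 _ _) (uM 0%N).
have [G [UG sG]] := ultraFilterLemma (F := \oo) _.
have FG : ProperFilter G by exact: ultra_proper.
pose B (w : seq 'I_d) : R := Num.sqrt (M ^+ 2 / gap q ^+ (size w * size w)).
have uB w k : cmod ((u k : words) w) <= B w.
  have g0 : 0 < gap q ^+ (size w * size w) by rewrite exprn_gt0 // gap_gt0.
  rewrite -[cmod _]ger0_norm ?cmod_ge0 // -sqrtr_sqr ler_wsqrtr //.
  rewrite ler_pdivlMr // mulrC; apply: le_trans (coord_le_hnorm _ _) _.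
  by rewrite lerXn2r ?nnegrE ?hnorm_ge0.
have ImB z : `|complex.Im z| <= cmod z :> R.
  have := cmod_ge_Re ('i%C * z); rewrite cmodM.
  have -> : cmod ('i%C : C) = 1 by rewrite /cmod normc_def /= expr0n add0r expr1n sqrtr1.
  by case: z => a b /=; rewrite mul0r mul1r sub0r normrN mul1r.
have [lr lrP] := choice (fun w => ultra_bounded_cvg UG
  (fun k => le_trans (cmod_ge_Re ((u k : words) w)) (uB w k))).
have [li liP] := choice (fun w => ultra_bounded_cvg UG
  (fun k => le_trans (ImB ((u k : words) w)) (uB w k))).
pose y : words := fun w => lr w +i* li w.
have zc w : cmod ((u k : words) w - y w) @[k --> G] --> (0 : R).
  have n0 (f : nat -> R) l : f k @[k --> G] --> l -> `|f k - l| @[k --> G] --> (0 : R).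
    move=> fl; rewrite -[X in _ --> X](@normr0 _ R) -(subrr l).
    by apply: cvg_norm; apply: cvgB => //; exact: cvg_cst.
  have h : `|complex.Re ((u k : words) w) - lr w| + `|complex.Im ((u k : words) w) - li w|
      @[k --> G] --> (0 : R).
    by rewrite -[X in _ --> X](addr0 (0 : R)); apply: cvgD; exact: n0.
  apply: (squeeze_cvgr _ (cvg_cst 0) h); near=> k; rewrite cmod_ge0 /=.
  by apply: le_trans (cmod_le_ReIm _) _; rewrite /y; case: ((u k : words) w).
have wc K (v : words) : rf (u k) (trunc K v) @[k --> G] --> \sum_(0 <= n < K) rqform n y v.
  rewrite (_ : (fun k => _) = (fun k => \sum_(0 <= n < K) rqform n (u k) v)); last first.
    by apply/funext => k; rewrite rform_trunc.
  apply: (@cvg_big _ _ _ _ _ _ _ _ _ _ _ _) => [|n _]; first exact: add_continuous.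
  have h := cvg_dqr_coord (z := fun k => (u k : words) - y) n v FG zc.
  rewrite (_ : (fun k => _) = (fun k => rqform n ((u k : words) - y) v + rqform n y v)).
    by rewrite -[X in _ --> X]add0r; apply: cvgD; [exact: h|exact: cvg_cst].
  by apply/funext => k; rewrite (rformDl (qform_psd d q1 n)) (rformNl (qform_psd d q1 n)) subrK.
(* With t the truncation of [y], |t|^2 = lim <u_k, t> <= M |t|, so |t| <= M for every [K]; this puts
   [y] in the Fock space. *)
have yM K : \sum_(0 <= n < K) qsqnorm n y <= M ^+ 2.
  have h : hn (trunc K y) ^+ 2 <= M * hn (trunc K y).
    rewrite hnorm_trunc; apply: (cvgr_to_le (wc K y)); near=> k.
    apply: le_trans (ler_norm _) _; apply: le_trans (rform_le_hnorm D _ _) _.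
    by rewrite ler_wpM2r ?hnorm_ge0.
  rewrite -hnorm_trunc; have [->|t0] := eqVneq (hn (trunc K y)) 0.
    by rewrite expr0n /= sqr_ge0.
  rewrite lerXn2r ?nnegrE ?hnorm_ge0 //.
  by move: h; rewrite expr2 ler_pM2r // lt_def t0 hnorm_ge0.
pose Y : F := QFock q1 (summable_of_bound yM).
exists G, Y; split=> // v.
have hY : hn Y <= M.
  by rewrite -ler_sqr ?nnegrE ?hnorm_ge0 //; apply: hnorm_le_bound.
apply/cvgrPdist_lt => e e0.
(* [K] is fixed before [k]: the tail of [v] is paired with [Y - u k], of norm at most 2 M, and [+ 1]
   keeps the divisor positive when M = 0. *)
have [K Ke] : exists K, hn (v - trunc K v) < e / 2 / (M + M + 1).
  have [K _ h] : \forall K \near \oo, hn (v - trunc K v) < e / 2 / (M + M + 1).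
    apply: (cvgr_lt _ (hnorm_sub_trunc v)).
    by rewrite !divr_gt0 // ltr_wpDl // addr_ge0.
  by exists K; exact: h (leqnn K).
have rfY : rf Y (trunc K v) = \sum_(0 <= n < K) rqform n y v by rewrite rform_trunc.
have /cvgrPdist_lt wcK := wc K v; rewrite -rfY in wcK.
near=> k.
have -> : rf Y v - rf (u k) v =
    (rf Y (trunc K v) - rf (u k) (trunc K v)) + rf (Y - u k) (v - trunc K v).
  by rewrite !(rformDl D, rformDr D, rformNl D, rformNr D); ring.
apply: le_lt_trans (ler_normD _ _) _; rewrite (splitr e); apply: ltr_leD.
  by near: k; apply: wcK; exact: divr_gt0.
apply: le_trans (rform_le_hnorm D _ _) _.
apply: (@le_trans _ _ ((M + M) * (e / 2 / (M + M + 1)))).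
  apply: ler_pM; rewrite ?hnorm_ge0 ?(ltW Ke) //.
  by apply: le_trans (hnormB D _ _) _; rewrite lerD.
rewrite mulrA ler_pdivrMr ?ltr_wpDl ?addr_ge0 // mulrC ler_pM2l ?divr_gt0 //.
by rewrite lerDl.
Unshelve. all: by end_near. Qed.

End Fock.

(** * Operators on the q-Fock space *)

Section FockOperators.
Local Open Scope classical_set_scope.
Context {R : realType}.
Variables (d : nat) (q : R) (q1 : -1 < q < 1).
Local Notation C := R[i].
Local Notation words := (@words R d).
Local Notation F := (@qFock R d q q1).
Local Notation qsqnorm := (@qsqnorm R d q).
Local Notation dot := (@qdot R d q q1).
Local Notation hn := (hnorm dot).
Local Notation D := (qdot_psd d q1).
Implicit Types (A B T : F -> F) (x y : F) (i j : 'I_d).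

(** Partial sums make the bound meaningful before [op x] is known to be summable; [K'] may differ
    from [K] because [op] can shift levels. *)
Record word_bounded (op : words -> words) := WordBounded {
  wb_linear : linear op;
  wb_bound : exists2 c : R, 0 <= c & forall (x : words) K, exists K',
    \sum_(0 <= n < K) qsqnorm n (op x) <= c * \sum_(0 <= n < K') qsqnorm n x }.

Lemma lift_summable op (h : word_bounded op) (x : F) : op x \in square_summable q.
Proof.
have [c c0 opc] := wb_bound h.
apply: (@summable_of_bound _ _ _ q1 _ (c * hn x ^+ 2)) => K; have [K' hK] := opc x K.
by apply: le_trans hK _; rewrite ler_wpM2l // sum_qsqnorm_le_hnorm.
Qed.

Definition lift op (h : word_bounded op) (x : F) : F := QFock q1 (lift_summable h x).

Lemma lift_linear op (h : word_bounded op) : linear (lift h).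
Proof. by move=> c x y; apply: Fval_inj; exact: (wb_linear h). Qed.

Lemma lift_bounded op (h : word_bounded op) : exists M : R, forall x, hn (lift h x) <= M * hn x.
Proof.
have [c c0 opc] := wb_bound h; exists (Num.sqrt c) => x.
rewrite -ler_sqr ?nnegrE ?mulr_ge0 ?sqrtr_ge0 ?hnorm_ge0 // exprMn [Num.sqrt c ^+ 2]sqr_sqrtr //.
apply: hnorm_le_bound => K; have [K' hK] := opc x K; apply: le_trans hK _.
by rewrite ler_wpM2l // sum_qsqnorm_le_hnorm.
Qed.

Let gapV_ge0 : 0 <= (gap q)^-1.
Proof. by rewrite invr_ge0 ltW // gap_gt0. Qed.

Lemma wb_lcreate i : word_bounded (@lcreate R d i).
Proof.
split; first exact: lcreate_linear.
exists (gap q)^-1 => // x [|K].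
  by exists 0%N; rewrite !big_nil mulr0.
exists K.
rewrite big_nat_recl //= qsqnorm_lcreate0 add0r mulr_sumr.
by apply: ler_sum => n _; exact: qsqnorm_lcreate.
Qed.

Lemma wb_lannih i : word_bounded (@lannih R d q i).
Proof.
split; first exact: lannih_linear.
exists (gap q)^-1 => // x K; exists K.+1.
rewrite big_nat_recl // mulrDr ler_wpDl ?mulr_ge0 ?qsqnorm_ge0 // mulr_sumr.
by apply: ler_sum => n _; exact: qsqnorm_lannih.
Qed.

Lemma wb_wrev_conj op : word_bounded op -> word_bounded (@wrev R d \o op \o @wrev R d).
Proof.
case=> [lop [c c0 opc]]; split.
  by move=> a x y; rewrite /comp wrev_linear lop wrev_linear.
exists c => // x K; have [K' hK] := opc (wrev x) K; exists K'.
under eq_bigr do rewrite qsqnorm_wrev; apply: le_trans hK _.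
by under eq_bigr do rewrite qsqnorm_wrev.
Qed.

Lemma wb_qnumber : word_bounded (@qnumber R d q).
Proof.
split; first exact: qnumber_linear.
exists 1 => // x K; exists K; rewrite mul1r; apply: ler_sum => n _.
rewrite qsqnorm_qnumber // ler_piMl ?qsqnorm_ge0 // -real_normK ?num_real // normrX.
by rewrite !exprn_ile1 ?exprn_ge0 // ltW // normq_lt1.
Qed.

Definition lcreateF i := lift (wb_lcreate i).
Definition lannihF i := lift (wb_lannih i).
Definition rcreateF i := lift (wb_wrev_conj (wb_lcreate i)).
Definition rannihF i := lift (wb_wrev_conj (wb_lannih i)).
Definition qnumberF := lift wb_qnumber.

Lemma lcreateFE i x : lcreateF i x = lcreate i x :> words. Proof. by []. Qed.
Lemma lannihFE i x : lannihF i x = lannih q i x :> words. Proof. by []. Qed.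
Lemma rcreateFE i x : rcreateF i x = rcreate i x :> words. Proof. by []. Qed.
Lemma rannihFE i x : rannihF i x = rannih q i x :> words. Proof. by []. Qed.

(** [A] raises the level by one, so the series for <A x, y> is that for <x, B y> shifted by one
    index with first term 0. Imaginary parts follow by linearity of [B]. *)
Lemma adjoint_of_levels A B : linear B ->
  (forall x y, rform (@qform R d q 0) (A x : words) (y : words) = 0) ->
  (forall n x y, rform (@qform R d q n.+1) (A x : words) (y : words) =
     rform (@qform R d q n) (x : words) (B y : words)) -> is_adjoint dot A B.
Proof.
move=> lB A0 AS x y.
have qreA z : qre (A x) z = qre x (B z).
  apply/cvg_lim => //; rewrite -cvg_shiftS.
  have -> : [sequence series (fun n => rform (@qform R d q n) (A x : words) (z : words)) n.+1]_n =
      series (fun n => rform (@qform R d q n) (x : words) (B z : words)).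
    apply/funext => n; rewrite /series /= big_nat_recl // A0 add0r.
    by apply: eq_bigr => k _; rewrite AS.
  exact: cvg_dqr.
by rewrite !qreE !qreA (linZ lB).
Qed.

Lemma lcreateF_adj i : is_adjoint dot (lcreateF i) (lannihF i).
Proof.
apply: adjoint_of_levels => [|x y|n x y]; first exact: lift_linear.
  by rewrite /rform qform0 mul0r.
by rewrite /rform qform_lcreate.
Qed.

Lemma rcreateF_adj i : is_adjoint dot (rcreateF i) (rannihF i).
Proof.
apply: adjoint_of_levels => [|x y|n x y]; first exact: lift_linear.
  by rewrite /rform qform0 mul0r.
by rewrite /rform qform_rcreate.
Qed.

Lemma qnumberF_adj : is_adjoint dot (qnumberF) (qnumberF).
Proof.
have qreN x y : qre (qnumberF x) y = qre x (qnumberF y).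
  congr (limn (series _)); apply/funext => n.
  have h z : level n (qnumber q z) = level n ((q ^+ n)%:C *: z : words).
    by apply/funext => w; rewrite /level /qnumber size_tuple.
  transitivity (rform (@qform R d q n) ((q ^+ n)%:C *: (x : words)) (y : words)).
    by rewrite /rform; congr complex.Re; exact: qform_level (h _) erefl.
  rewrite (rformZl (qform_psd d q1 n)) -(rformZr (qform_psd d q1 n)) /rform.
  by congr complex.Re; exact: qform_level erefl (esym (h _)).
have lqN : linear qnumberF by exact: lift_linear.
by move=> x y; rewrite !qreE !qreN (linZ lqN).
Qed.

Definition vanish n (x : words) := forall w, (size w < n)%N -> x w = 0.

(** [tame_lowers] preserves decay on high levels under composition on the right, and [tame_adjoint]
    supplies T^* T for the spectral theorem. *)
Record tame T : Prop := Tame {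
  tame_linear : linear T;
  tame_bounded : exists2 M : R, 0 <= M & forall x, hn (T x) <= M * hn x;
  tame_lowers : exists m, forall n (x : F), vanish n x -> vanish (n - m) (T x);
  tame_adjoint : exists T', is_adjoint dot T T' }.

Lemma adjointC A B : is_adjoint dot A B -> is_adjoint dot B A.
Proof. by move=> h x y; rewrite (psdC D) -h -(psdC D). Qed.

Lemma adjoint_unique A B B' : is_adjoint dot A B -> is_adjoint dot A B' -> B = B'.
Proof.
move=> h h'; apply/funext => y; apply: (rform_ext D (@qdot_definite _ _ _ q1)) => v.
by rewrite (rformC D) [RHS](rformC D) /rform -h -h'.
Qed.

Lemma adjoint_comp A A' B B' : is_adjoint dot A A' -> is_adjoint dot B B' ->
  is_adjoint dot (A \o B) (B' \o A').
Proof. by move=> h h' x y; rewrite /= h h'. Qed.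

Lemma adjoint_add A A' B B' : is_adjoint dot A A' -> is_adjoint dot B B' ->
  is_adjoint dot (A + B) (A' + B').
Proof. by move=> h h' x y; rewrite !fctE (psdDl D) (psdDr D) h h'. Qed.

Lemma adjoint_scale c A A' : is_adjoint dot A A' -> is_adjoint dot (c *: A) (c^*%R *: A').
Proof. by move=> h x y; rewrite !fctE (psdZl D) (psdZr D) conjCK h. Qed.

Lemma tame_id : tame id.
Proof.
split=> //; first by exists 1 => // x; rewrite mul1r.
  by exists 0%N => n x; rewrite subn0.
by exists id.
Qed.

Lemma tame_comp A B : tame A -> tame B -> tame (A \o B).
Proof.
case=> lA [M M0 hM] [m hm] [A' hA] [lB [N N0 hN] [k hk] [B' hB]].
split; first by move=> c x y; rewrite /= lB lA.
- exists (M * N) => [|x]; first exact: mulr_ge0.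
  by apply: le_trans (hM _) _; rewrite -mulrA ler_wpM2l.
- by exists (k + m)%N => n x vx /=; rewrite subnDA; apply/hm/hk.
by exists (B' \o A'); exact: adjoint_comp.
Qed.

Lemma tame_add A B : tame A -> tame B -> tame (A + B).
Proof.
case=> lA [M M0 hM] [m hm] [A' hA] [lB [N N0 hN] [k hk] [B' hB]].
split; first by move=> c x y; rewrite !fctE lB lA scalerDr addrACA.
- exists (M + N) => [|x]; first exact: addr_ge0.
  by rewrite mulrDl; apply: le_trans (hnormD D _ _) (lerD _ _).
- exists (m + k)%N => n x vx w wn; rewrite !fctE.
  rewrite -[LHS]/((A x : words) w + (B x : words) w) (hm n) ?(hk n) ?addr0 //.
    by apply: leq_trans wn _; rewrite leq_sub2l // leq_addl.
  by apply: leq_trans wn _; rewrite leq_sub2l // leq_addr.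
by exists (A' + B'); exact: adjoint_add.
Qed.

Lemma tame_scale c A : tame A -> tame (c *: A).
Proof.
case=> lA [M M0 hM] [m hm] [A' hA].
split; first by move=> a x y; rewrite !fctE lA scalerDr !scalerA mulrC.
- exists (cmod c * M) => [|x]; first by rewrite mulr_ge0 ?cmod_ge0.
  by rewrite fctE (hnormZ D) -mulrA ler_wpM2l ?cmod_ge0.
- exists m => n x vx w wn; rewrite fctE.
  by rewrite -[LHS]/(c *: (A x : words) w) (hm n) // scaler0.
by exists (c^*%R *: A'); exact: adjoint_scale.
Qed.

Lemma tame_zero : tame 0.
Proof. by rewrite -(scale0r (id : F -> F)); exact/tame_scale/tame_id. Qed.

Lemma tame_lift op (h : word_bounded op) m T' :
  (forall n x, vanish n x -> vanish (n - m) (op x)) -> is_adjoint dot (lift h) T' ->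
  tame (lift h).
Proof.
move=> opm adj; split; [exact: lift_linear| |by exists m => n x; exact: opm|by exists T'].
have [M hM] := lift_bounded h; exists `|M| => // x.
by apply: le_trans (hM x) _; rewrite ler_wpM2r ?hnorm_ge0 ?ler_norm.
Qed.

Lemma vanish_lcreate i n (x : words) : vanish n x -> vanish (n - 0) (lcreate i x).
Proof.
move=> vx [|j w]; rewrite subn0 // => wn; rewrite lcreate_cons vx ?mulr0 //.
by apply: leq_ltn_trans wn; rewrite /= leqnSn.
Qed.

Lemma vanish_lannih i n (x : words) : vanish n x -> vanish (n - 1) (lannih q i x).
Proof.
move=> vx w wn; rewrite /lannih big1 // => k _; rewrite vx ?mulr0 // size_insert_at.
by move: wn; rewrite ltn_subRL add1n.
Qed.

Lemma vanish_wrev n (x : words) : vanish n x -> vanish n (wrev x).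
Proof. by move=> vx w wn; rewrite /wrev vx // size_rev. Qed.

Lemma tame_lcreateF i : tame (lcreateF i).
Proof. by apply: tame_lift (lcreateF_adj i) => n x; exact: vanish_lcreate. Qed.

Lemma tame_lannihF i : tame (lannihF i).
Proof. by apply: tame_lift (adjointC (lcreateF_adj i)) => n x; exact: vanish_lannih. Qed.

Lemma tame_rcreateF i : tame (rcreateF i).
Proof.
apply: tame_lift (rcreateF_adj i) => n x vx.
exact: (vanish_wrev (@vanish_lcreate i _ _ (vanish_wrev vx))).
Qed.

Lemma tame_rannihF i : tame (rannihF i).
Proof.
apply: tame_lift (adjointC (rcreateF_adj i)) => n x vx.
exact: (vanish_wrev (@vanish_lannih i _ _ (vanish_wrev vx))).
Qed.

Lemma tame_qnumberF : tame qnumberF.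
Proof.
apply: (tame_lift (m := 0)) qnumberF_adj => n x vx w; rewrite subn0 => wn.
by rewrite /qnumber vx // mulr0.
Qed.

(** * The two-sided ideal of operators decaying geometrically on high levels *)

Section TailIdeal.
Variable r : R.
Hypotheses (r_gt0 : 0 < r) (r_le1 : r <= 1) (q_le_r : `|q| <= r).

Record tail_ideal T : Prop := TailIdeal {
  tail_tame : tame T;
  tail_bound : exists2 c : R, 0 <= c &
    forall n (x : F), vanish n x -> hn (T x) <= c * r ^+ n * hn x }.

Lemma tail_add A B : tail_ideal A -> tail_ideal B -> tail_ideal (A + B).
Proof.
case=> tA [a a0 hA] [tB [b b0 hB]]; split; first exact: tame_add.
exists (a + b) => [|n x vx]; first exact: addr_ge0.
rewrite !mulrDl; apply: le_trans (hnormD D _ _) (lerD (hA _ _ vx) (hB _ _ vx)).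
Qed.

Lemma tail_scale c A : tail_ideal A -> tail_ideal (c *: A).
Proof.
case=> tA [a a0 hA]; split; first exact: tame_scale.
exists (cmod c * a) => [|n x vx]; first by rewrite mulr_ge0 ?cmod_ge0.
by rewrite fctE (hnormZ D) -!mulrA ler_wpM2l ?cmod_ge0 // mulrA hA.
Qed.

Lemma tail_zero : tail_ideal 0.
Proof.
split; first exact: tame_zero.
by exists 0 => // n x _; rewrite !mul0r -[(0 : F -> F) x]/(0 : F) (hnorm0 D).
Qed.

Lemma tail_compl A T : tame A -> tail_ideal T -> tail_ideal (A \o T).
Proof.
move=> tA [tT [a a0 hT]]; have [M M0 hM] := tame_bounded tA.
split; first exact: tame_comp.
exists (M * a) => [|n x vx]; first exact: mulr_ge0.
by apply: le_trans (hM _) _; rewrite -!mulrA ler_wpM2l // mulrA hT.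
Qed.

Lemma tail_compr A T : tame A -> tail_ideal T -> tail_ideal (T \o A).
Proof.
move=> tA [tT [a a0 hT]]; have [M M0 hM] := tame_bounded tA.
have [m hm] := tame_lowers tA.
split; first exact: tame_comp.
exists (a * (r ^- m * M)) => [|n x vx].
  by rewrite !mulr_ge0 ?invr_ge0 ?exprn_ge0 ?(ltW r_gt0).
apply: le_trans (hT _ _ (hm _ _ vx)) _; rewrite -!mulrA ler_wpM2l //.
(* The subtraction is truncated, but [n <= m + (n - m)] always holds, and [r <= 1] turns it into
   this inequality. *)
have rn : r ^+ (n - m) <= r ^- m * r ^+ n.
  rewrite ler_pdivlMl ?exprn_gt0 // -exprD; apply: ler_wiXn2l => //; first exact: ltW.
  by rewrite -leq_subLR.
apply: le_trans (ler_pM _ _ rn (hM x)) _; rewrite ?hnorm_ge0 ?exprn_ge0 ?(ltW r_gt0) //.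
by rewrite -mulrA ler_wpM2l ?invr_ge0 ?exprn_ge0 ?(ltW r_gt0) // mulrCA.
Qed.

Lemma tail_qnumberF : tail_ideal qnumberF.
Proof.
split; first exact: tame_qnumberF.
exists 1 => // n x vx; rewrite mul1r.
have r0 : 0 <= r ^+ n by rewrite exprn_ge0 // ltW.
rewrite -ler_sqr ?nnegrE ?mulr_ge0 ?hnorm_ge0 // exprMn.
apply: hnorm_le_bound => K.
apply: (@le_trans _ _ ((r ^+ n) ^+ 2 * \sum_(0 <= k < K) qsqnorm k x)); last first.
  by rewrite ler_wpM2l ?sqr_ge0 // sum_qsqnorm_le_hnorm.
rewrite mulr_sumr; apply: ler_sum => k _; rewrite qsqnorm_qnumber //.
have [kn|nk] := ltnP k n.
  suff -> : qsqnorm k x = 0 by rewrite !mulr0.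
  rewrite qsqnormE /rform; have -> : qform q k x x = qform q k 0 x.
    apply: qform_level => //; apply/funext => w.
    by rewrite /level vx // size_tuple.
  by rewrite (psd0l (qform_psd d q1 k)).
rewrite ler_wpM2r ?qsqnorm_ge0 // -real_normK ?num_real // normrX.
rewrite lerXn2r ?nnegrE ?exprn_ge0 ?(ltW r_gt0) //.
apply: (@le_trans _ _ (r ^+ k)); first by rewrite lerXn2r ?nnegrE ?(ltW r_gt0).
by apply: ler_wiXn2l => //; exact: ltW.
Qed.

End TailIdeal.

(** The elementary tensor of basis vectors spelled by [w]. In general these are neither orthogonal
    nor normalized for [qdot], so coefficients are not inner products. *)
Definition basis_vec (w : seq 'I_d) : F :=
  trunc q1 (size w).+1 (fun v => (v == w)%:R).

Lemma basis_vecE w v : (basis_vec w : words) v = (v == w)%:R.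
Proof.
rewrite /= /trunc_words; case: ifP => //; case: eqP => // ->.
by rewrite ltnSn.
Qed.

Fixpoint words_below n : seq (seq 'I_d) :=
  if n is m.+1 then words_below m ++ map val (enum {: m.-tuple 'I_d}) else [::].

Lemma mem_words_below n w : (w \in words_below n) = (size w < n)%N.
Proof.
elim: n => [|n IHn]; rewrite ?in_nil //= mem_cat IHn ltnS [RHS]leq_eqVlt orbC.
congr orb; apply/mapP/idP => [[t _ ->]|sw]; first by rewrite size_tuple.
by exists (Tuple sw) => //; rewrite mem_enum.
Qed.

Lemma uniq_words_below n : uniq (words_below n).
Proof.
elim: n => [|n IHn] //=; rewrite cat_uniq IHn map_inj_uniq ?enum_uniq //; last exact: val_inj.
rewrite andbT; apply/hasPn => w /mapP[t _ ->].
by rewrite mem_words_below size_tuple ltnn.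
Qed.

Lemma size_words_below n : size (words_below n) = (\sum_(k < n) d ^ k)%N.
Proof.
elim: n => [|n IHn]; first by rewrite big_ord0.
by rewrite size_cat IHn size_map -cardE card_tuple card_ord big_ord_recr.
Qed.

Lemma Fsum_apply (I : Type) (s : seq I) (u : I -> F) v :
  ((\sum_(i <- s) u i : F) : words) v = \sum_(i <- s) (u i : words) v.
Proof. by elim/big_rec2: _ => // i a b _ <-. Qed.

Lemma trunc_decomp K (x : words) :
  trunc q1 K x = \sum_(w <- words_below K) x w *: basis_vec w.
Proof.
apply: Fval_inj; apply/funext => v; rewrite Fsum_apply.
have e w : ((x w *: basis_vec w : F) : words) v = x w * (v == w)%:R.
  by rewrite -basis_vecE.
under eq_bigr do rewrite e; rewrite /= /trunc_words -mem_words_below.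
case: ifPn => vK.
  rewrite (bigD1_seq v) ?uniq_words_below //= eqxx mulr1 big1 ?addr0 // => w wv.
  by rewrite eq_sym (negPf wv) mulr0.
rewrite big1_seq // => w /andP[_ wK]; case: eqP => [vw|]; last by rewrite mulr0.
by rewrite vw wK in vK.
Qed.

(** For t the truncation of x, |t|^2 = <x, t> expands over the words below level n, with
    coefficients at most K |t| by [coord_le_hnorm]; dividing by |t| avoids inverting a Gram
    matrix. *)
Lemma hnorm_trunc_le_coords n : exists2 K : R, 0 <= K & forall x,
  hn (trunc q1 n x) <= K * \sum_(w <- words_below n) cmod (dot x (basis_vec w)).
Proof.
have g0 : 0 < gap q := gap_gt0 q1.
pose K : R := Num.sqrt (gap q ^- (n * n)); exists K; first exact: sqrtr_ge0.
move=> x; set t := trunc _ _ _.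
have coord w : w \in words_below n -> cmod ((x : words) w) <= K * hn t.
  rewrite mem_words_below => wn; have := coord_le_hnorm t w.
  have -> : (t : words) w = (x : words) w by rewrite /= /trunc_words wn.
  move=> h; rewrite -ler_sqr ?nnegrE ?mulr_ge0 ?sqrtr_ge0 ?hnorm_ge0 ?cmod_ge0 //.
  rewrite exprMn [K ^+ 2]sqr_sqrtr ?invr_ge0 ?exprn_ge0 ?(ltW g0) //.
  rewrite ler_pdivlMl ?exprn_gt0 //; apply: le_trans h; rewrite ler_wpM2r ?sqr_ge0 //.
  apply: ler_wiXn2l; rewrite ?(ltW g0) //; first by rewrite /gap gerBl.
  by apply: leq_mul; exact: ltnW.
have [->|t0] := eqVneq (hn t) 0.
  by rewrite mulr_ge0 ?sqrtr_ge0 // sumr_ge0 // => w _; exact: cmod_ge0.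
have tp : 0 < hn t by rewrite lt_def t0 hnorm_ge0.
rewrite -(ler_pM2l tp) -expr2 (hnorm_sq D).
have -> : rform dot t t = rform dot x t.
  by rewrite -(hnorm_sq D) hnorm_trunc rform_trunc.
rewrite {1}/t trunc_decomp /rform (psd_sumr D) Re_sum mulrA [hn t * K]mulrC mulr_sumr.
rewrite big_seq [leRHS]big_seq; apply: ler_sum => w wn.
rewrite (psdZr D); apply: le_trans (ler_norm _) _; apply: le_trans (cmod_ge_Re _) _.
rewrite cmodM ler_wpM2r ?cmod_ge0 //.
suff -> : cmod ((x : words) w)^*%R = cmod ((x : words) w) by exact: coord.
by rewrite /cmod norm_conjC.
Qed.

Lemma hnorm_sub_trunc_le n x : hn (x - trunc q1 n x) <= hn x.
Proof.
rewrite -ler_sqr ?nnegrE ?hnorm_ge0 // hnorm_sub_trunc_sq gerBl; exact: sum_qsqnorm_ge0.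
Qed.

Lemma vanish_sub_trunc n x : vanish n ((x - trunc q1 n x : F) : words).
Proof.
move=> w wn; rewrite -[LHS]/((x : words) w - trunc_words n x w) /trunc_words wn.
by rewrite subrr.
Qed.

Lemma sum_succ_geometric (t : R) N : 0 <= t -> t < 1 ->
  \sum_(n < N) n.+1%:R * t ^+ n <= (1 - t) ^- 2.
Proof.
move=> t0 t1; have p : 0 < (1 - t) ^+ 2 by rewrite exprn_gt0 // subr_gt0.
rewrite -[leRHS]mul1r ler_pdivlMr //.
suff -> : (\sum_(n < N) n.+1%:R * t ^+ n) * (1 - t) ^+ 2 =
    1 - t ^+ N - N%:R * t ^+ N * (1 - t).
  have := exprn_ge0 N t0; have : 0 <= N%:R * t ^+ N * (1 - t).
    by rewrite !mulr_ge0 ?exprn_ge0 // subr_ge0 ltW.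
  by lra.
elim: N => [|N IHN]; first by rewrite big_ord0 expr0; ring.
by rewrite big_ord_recr mulrDl IHN /= ![t ^+ N.+1]exprS -![N.+1%:R]natr1; ring.
Qed.

(** With m = [maxn d 1], which also covers d = 0, there are at most (n + 1) m^n words of length at
    most n. The factor n + 1 is harmless: the sum of (n + 1) (r^s m)^n still converges. *)
Lemma schatten_of_tail (r : R) (p : \bar R) T : 0 < r -> r < 1 -> (0 < p)%E ->
  (forall s : R, p = s%:E -> r `^ s * (maxn d 1)%:R < 1) ->
  tail_ideal r T -> schatten dot p T.
Proof.
move=> r0 r1 p0 rp [tT [c c0 hT]]; have [lT [M M0 hM] _ [T' adjT]] := tT.
pose eps n := c * r ^+ n.
have eps0 n : 0 <= eps n by rewrite mulr_ge0 ?exprn_ge0 // ltW.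
apply: (@schatten_of_approx _ _ _ D (@qdot_definite _ _ _ q1) (@qFock_weak_compact _ _ _ q1)
  T (T' \o T) lT _ (fun n => \sum_(k < n) d ^ k)%N eps) => //.
- by move=> x y; rewrite [RHS](psdC D) adjT -(psdC D).
- by rewrite big_ord0.
- rewrite -[X in _ --> X](mulr0 c); apply: cvgMr; apply: cvg_expr.
  by rewrite ger0_norm // ltW.
- move=> n; have [K K0 hK] := hnorm_trunc_le_coords n.
  exists (M * K), (map basis_vec (words_below n)).
  split; first by rewrite size_map size_words_below.
  move=> x; rewrite big_map -mulrA.
  (* The first summand lives on levels at least [n], where [T] decays; the second is controlled by
     finitely many functionals. *)
  have {1}-> : x = (x - trunc q1 n x) + trunc q1 n x by rewrite subrK.
  rewrite (linD lT); apply: le_trans (hnormD D _ _) _; apply: lerD.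
    apply: le_trans (hT n _ (@vanish_sub_trunc n x)) _.
    by apply: ler_wpM2l; [exact: eps0|exact: hnorm_sub_trunc_le].
  by apply: le_trans (hM _) _; rewrite ler_wpM2l.
move=> s ps; have sp : 0 < s by move: p0; rewrite ps lte_fin.
pose m := maxn d 1; pose t := r `^ s * m%:R.
have t0 : 0 <= t by rewrite mulr_ge0 ?powR_ge0.
have t1 : t < 1 by exact: rp.
exists (c `^ s * (1 - t) ^- 2) => N.
apply: le_trans (ler_wpM2l (powR_ge0 _ _) (sum_succ_geometric N t0 t1)).
rewrite mulr_sumr; apply: ler_sum => n _.
have -> : eps n `^ s = c `^ s * (r `^ s) ^+ n.
  rewrite powRM ?exprn_ge0 ?(ltW r0) //; congr (_ * _).
  by rewrite -powR_mulrn ?(ltW r0) // -powRrM mulrC powRrM powR_mulrn ?powR_ge0.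
rewrite mulrCA ler_wpM2l ?powR_ge0 // /t exprMn.
rewrite mulrC [leRHS]mulrCA ler_wpM2l ?exprn_ge0 ?powR_ge0 //.
rewrite -natrX -natrM ler_nat.
have -> : (n.+1 * m ^ n = \sum_(k < n.+1) m ^ n)%N by rewrite sum_nat_const card_ord.
apply: leq_sum => k _; apply: (@leq_trans (m ^ k)%N).
  by case: (val k) => [|l] //; rewrite leq_exp2r // leq_maxl.
by rewrite leq_pexp2l ?leq_maxr // -ltnS.
Qed.

End FockOperators.

(** * The q-Gaussian algebra *)

Section GaussianAlgebra.
Local Open Scope classical_set_scope.
Context {R : realType}.
Variables (d : nat) (q : R) (q1 : -1 < q < 1).
Local Notation C := R[i].
Local Notation words := (@words R d).
Local Notation F := (@qFock R d q q1).
Local Notation dot := (@qdot R d q q1).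
Local Notation hn := (hnorm dot).
Local Notation D := (qdot_psd d q1).
Local Notation Omega := (vacuum d q1).
Local Notation delta := (@basis_vec R d q q1).
Local Notation qnumberF := (@qnumberF R d q q1).
Local Notation l := (@lcreateF R d q q1).
Local Notation ls := (@lannihF R d q q1).
Local Notation r := (@rcreateF R d q q1).
Local Notation rs := (@rannihF R d q q1).
Implicit Types (a b A B T : F -> F) (x y : F) (i j : 'I_d).

Definition lgauss i : F -> F := l i + ls i.
Definition rgauss i : F -> F := r i + rs i.

(* Unlike [Aq], there is no closure under adjoints: for selfadjoint generators
   it is automatic, see [alg_adjoint]. *)
Inductive gen_alg (g : 'I_d -> F -> F) : (F -> F) -> Prop :=
| alg_gen i : gen_alg g (g i)
| alg_one : gen_alg g id
| alg_add a b : gen_alg g a -> gen_alg g b -> gen_alg g (a + b)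
| alg_scale (c : C) a : gen_alg g a -> gen_alg g (c *: a)
| alg_mul a b : gen_alg g a -> gen_alg g b -> gen_alg g (a \o b).

Lemma alg_zero g : gen_alg g 0.
Proof. by rewrite -(scale0r (id : F -> F)); exact/alg_scale/alg_one. Qed.

Lemma alg_sum g (I : Type) (s : seq I) (u : I -> F -> F) :
  (forall k, gen_alg g (u k)) -> gen_alg g (\sum_(k <- s) u k).
Proof.
by move=> gu; elim/big_rec: _ => [|i a _ ga]; [exact: alg_zero|exact: alg_add].
Qed.

Lemma tame_alg g a : (forall i, tame (g i)) -> gen_alg g a -> tame a.
Proof.
move=> gt; elim=> [i||b c _ ? _ ?|c b _ ?|b c _ ? _ ?]; [exact: gt|exact: tame_id| | |].
- exact: tame_add.
- exact: tame_scale.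
- exact: tame_comp.
Qed.

Lemma alg_adjoint g a : (forall i, is_adjoint dot (g i) (g i)) -> gen_alg g a ->
  exists2 a', gen_alg g a' & is_adjoint dot a a'.
Proof.
move=> gg; elim=> [i||b c _ [b' gb' bb'] _ [c' gc' cc']|c b _ [b' gb' bb']|
    b c _ [b' gb' bb'] _ [c' gc' cc']].
- by exists (g i) => //; exact: alg_gen.
- by exists id => //; exact: alg_one.
- by exists (b' + c'); [exact: alg_add|exact: adjoint_add].
- by exists (c^*%R *: b'); [exact: alg_scale|exact: adjoint_scale].
- by exists (c' \o b'); [exact: alg_mul|exact: adjoint_comp].
Qed.

Lemma alg_commute g a B : (forall x y, B (x + y) = B x + B y) ->
  (forall c x, B (c *: x) = c *: B x) ->
  (forall i x, g i (B x) = B (g i x)) -> gen_alg g a -> forall x, a (B x) = B (a x).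
Proof.
move=> BD BZ gB; elim=> [i x||b c _ bB _ cB x|c b _ bB x|b c _ bB _ cB x] //.
- by rewrite !fctE bB cB BD.
- by rewrite !fctE bB BZ.
- by rewrite /= cB bB.
Qed.

Lemma tame_lgauss i : tame (lgauss i).
Proof. by apply: tame_add; [exact: tame_lcreateF|exact: tame_lannihF]. Qed.

Lemma tame_rgauss i : tame (rgauss i).
Proof. by apply: tame_add; [exact: tame_rcreateF|exact: tame_rannihF]. Qed.

Lemma lgauss_adj i : is_adjoint dot (lgauss i) (lgauss i).
Proof.
rewrite {2}/lgauss addrC; apply: adjoint_add; first exact: lcreateF_adj.
exact/adjointC/lcreateF_adj.
Qed.

Lemma l_r i j x : l i (r j x) = r j (l i x).
Proof. by apply: Fval_inj; exact: lcreate_rcreate. Qed.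

(** Obtained from [l_r] by taking adjoints, which spares the combinatorics of double insertions. *)
Lemma ls_rs i j x : ls i (rs j x) = rs j (ls i x).
Proof.
have h1 := adjoint_comp (@rcreateF_adj _ _ _ q1 j) (@lcreateF_adj _ _ _ q1 i).
have h2 := adjoint_comp (@lcreateF_adj _ _ _ q1 i) (@rcreateF_adj _ _ _ q1 j).
have e : r j \o l i = l i \o r j by apply/funext => y; rewrite /= l_r.
by rewrite e in h1; exact: (congr1 (fun f => f x) (adjoint_unique h1 h2)).
Qed.

Lemma ls_r i j x : ls i (r j x) = r j (ls i x) + (i == j)%:R *: qnumberF x.
Proof. by apply: Fval_inj; exact: lannih_rcreate. Qed.

Lemma rs_l i j x : rs i (l j x) = l j (rs i x) + (i == j)%:R *: qnumberF x.
Proof. by apply: Fval_inj; exact: rannih_lcreate. Qed.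

(** Each side produces the same term q^N when i = j, one from l_i^* r_j and the other from r_j^*
    l_i. *)
Lemma lgauss_rgauss i j x : lgauss i (rgauss j x) = rgauss j (lgauss i x).
Proof.
rewrite /lgauss /rgauss !fctE (linD (tame_linear (tame_lcreateF q1 i))).
rewrite (linD (tame_linear (tame_lannihF q1 i))).
rewrite (linD (tame_linear (tame_rcreateF q1 j))) (linD (tame_linear (tame_rannihF q1 j))).
rewrite l_r ls_rs ls_r rs_l eq_sym.
by rewrite -!addrA; congr (_ + _); rewrite [LHS]addrCA.
Qed.

Lemma lalg_ralg a B x : gen_alg lgauss a -> gen_alg rgauss B -> a (B x) = B (a x).
Proof.
move=> la rB; have tB := tame_linear (tame_alg tame_rgauss rB).
apply: (alg_commute (linD tB) (linZ tB)) la x => i x.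
have tg := tame_linear (tame_lgauss i).
by apply/esym; apply: (alg_commute (linD tg) (linZ tg)) rB x => j x; rewrite lgauss_rgauss.
Qed.

Lemma OmegaE w : (Omega : words) w = (w == [::])%:R.
Proof.
rewrite /= /embed; case: insubP => [u /eqP su uw|]; last by case: w.
by rewrite (size0nil su) /= /elem big_ord0.
Qed.

Lemma Omega_delta : Omega = delta [::].
Proof. by apply: Fval_inj; apply/funext => w; rewrite OmegaE basis_vecE. Qed.

Lemma lannih_Omega i : ls i Omega = 0.
Proof.
apply: Fval_inj; apply/funext => w; rewrite lannihFE /lannih big1 // => k _.
by rewrite OmegaE -size_eq0 size_insert_at mulr0.
Qed.

Lemma wrev_Omega : wrev (Omega : words) = Omega.
Proof. by apply/funext => w; rewrite /wrev !OmegaE -!size_eq0 size_rev. Qed.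

Lemma rannihF_Omega i : rs i Omega = 0.
Proof.
apply: Fval_inj; rewrite rannihFE /rannih wrev_Omega.
by have := congr1 (fun z : F => wrev (z : words)) (lannih_Omega i).
Qed.

Lemma lcreateF_Omega i : l i Omega = r i Omega.
Proof.
apply: Fval_inj; rewrite lcreateFE rcreateFE; apply/funext => -[|j w] //.
rewrite /rcreate wrev_Omega lcreate_cons OmegaE /wrev.
case/lastP: w => [|w k]; first by rewrite -[rev _]/[:: j] lcreate_cons OmegaE.
rewrite -rcons_cons rev_rcons lcreate_cons OmegaE -!size_eq0 size_rcons size_rev.
by rewrite !mulr0.
Qed.

(* B is the right multiplication by b. *)
Lemma right_mult b : gen_alg lgauss b -> exists2 B, gen_alg rgauss B & B Omega = b Omega.
Proof.
elim=> [i||a c _ [A rA Ao] _ [B rB Bo]|c a _ [A rA Ao]|a c la [A rA Ao] lc [B rB Bo]].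
- exists (rgauss i); first exact: alg_gen.
  by rewrite /rgauss /lgauss !fctE rannihF_Omega lannih_Omega lcreateF_Omega.
- by exists id; first exact: alg_one.
- by exists (A + B); [exact: alg_add|rewrite !fctE Ao Bo].
- by exists (c *: A); [exact: alg_scale|rewrite !fctE Ao].
(* Right multiplications compose in reverse order: a (c Omega) = a (B Omega) = B (a Omega) = B (A
   Omega). *)
- exists (B \o A); first exact: alg_mul.
  by rewrite /= Ao -lalg_ralg // Bo.
Qed.

(** Kept on arbitrary families, because its values on the Fock space need not be square summable. *)
Definition number_op (x : words) : words := fun w => (size w)%:R * x w.

Lemma num_linear : linear number_op.
Proof.
move=> c x y; apply/funext => w; rewrite !fctE /number_op.
by rewrite mulrDr [in RHS]/GRing.scale /= mulrCA.
Qed.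

Lemma num_lcreate i (x : words) :
  number_op (lcreate i x) = lcreate i (number_op x) + lcreate i x.
Proof.
apply/funext => -[|j w]; rewrite !fctE /number_op ?mul0r ?lcreate_nil ?addr0 //.
by rewrite !lcreate_cons /= -natr1; ring.
Qed.

Lemma num_lannih i (x : words) :
  number_op (lannih q i x) = lannih q i (number_op x) - lannih q i x.
Proof.
apply/funext => w; rewrite !fctE /number_op /lannih mulr_sumr -sumrB; apply: eq_bigr => k _.
by rewrite size_insert_at -natr1; ring.
Qed.

Lemma num_basis_vec w : number_op (basis_vec q1 w) = ((size w)%:R *: delta w : F) :> words.
Proof.
apply/funext => v; rewrite /number_op -[RHS]/((size w)%:R * (delta w : words) v).
by rewrite basis_vecE; case: eqP => [->//|_]; rewrite !mulr0.
Qed.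

(** * Commutators with the number operator and with right multiplications *)

Section Commutators.
Variable t : R.
Hypotheses (t_gt0 : 0 < t) (t_le1 : t <= 1) (q_le_t : `|q| <= t).
Local Notation tail := (@tail_ideal R d q q1 t).

Definition commutator A B x : F := A (B x) - B (A x).

(** Here l_i - l_i^* is [N, l_i + l_i^* ]. The changed sign makes the two terms q^N, which cancel in
    [lgauss_rgauss], add up instead. *)
Lemma tail_commutator_gen i j : tail (commutator (l i - ls i) (rgauss j)).
Proof.
have -> : commutator (l i - ls i) (rgauss j) = (- ((i == j)%:R *+ 2) : C) *: qnumberF.
  apply/funext => x; rewrite /commutator /rgauss !fctE.
  rewrite (linD (tame_linear (tame_lcreateF q1 i))) (linD (tame_linear (tame_lannihF q1 i))).
  rewrite (linB (tame_linear (tame_rcreateF q1 j))) (linB (tame_linear (tame_rannihF q1 j))).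
  rewrite l_r ls_rs ls_r rs_l [j == i]eq_sym scaleNr mulr2n scalerDl.
  move: (r j (l i x)) (l i (rs j x)) (r j (ls i x)) (rs j (ls i x)) => a b c e.
  move: (_ *: qnumberF x) => n.
  have -> : c + n + e = c + e + n by rewrite addrAC.
  have -> : a - c + (b + n - e) = a + b - (c + e) + n.
    by rewrite [b + n - e]addrAC addrA addrACA -opprD.
  have -> : a + b - (c + e + n) = a + b - (c + e) - n by rewrite opprD addrA.
  by move: (a + b - (c + e)) => z; rewrite opprD addrACA subrr add0r opprD.
exact/tail_scale/tail_qnumberF.
Qed.

Lemma tail_commutator A : tame A ->
  (forall j, tail (commutator A (rgauss j))) ->
  forall B, gen_alg rgauss B -> tail (commutator A B).
Proof.
move=> tA AG B; have lA := tame_linear tA.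
elim=> [j|| B1 B2 _ h1 _ h2|c B1 _ h1|B1 B2 g1 h1 g2 h2]; first exact: AG.
- have -> : commutator A id = 0; last exact: tail_zero.
  by apply/funext => x; rewrite /commutator subrr.
- have -> : commutator A (B1 + B2) = commutator A B1 + commutator A B2; last exact: tail_add.
  by apply/funext => x; rewrite /commutator !fctE (linD lA) opprD addrACA.
- have -> : commutator A (c *: B1) = c *: commutator A B1; last exact: tail_scale.
  by apply/funext => x; rewrite /commutator !fctE (linZ lA) scalerBr.
have t1 := tame_alg tame_rgauss g1; have t2 := tame_alg tame_rgauss g2.
have -> : commutator A (B1 \o B2) = (commutator A B1 \o B2) + (B1 \o commutator A B2).
  apply/funext => x; rewrite /commutator !fctE /= (linB (tame_linear t1)).
  by rewrite addrA subrK.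
by apply: tail_add; [exact: tail_compr|exact: tail_compl].
Qed.

(* A = [N, a]; since N is unbounded, y is assumed to be N x. *)
Definition is_derivation a A := forall x y, y = number_op x :> words ->
  number_op (a x) = (a y + A x : F) :> words.

(** [A] is built along [a] by the Leibniz rule. In a product only [A1] and [A2] fail to commute with
    [B]: the factors [a1] and [a2] pass through it by [lalg_ralg], so the commutator stays in the
    ideal. *)
Lemma number_derivation a : gen_alg lgauss a -> exists A, [/\ tame A, is_derivation a A &
  forall B, gen_alg rgauss B -> tail (commutator A B)].
Proof.
elim=> [i||a1 a2 _ [A1 [t1 d1 h1]] _ [A2 [t2 d2 h2]]|c a1 _ [A1 [t1 d1 h1]]|
    a1 a2 g1 [A1 [t1 d1 h1]] g2 [A2 [t2 d2 h2]]].
- have tA : tame (l i - ls i).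
    apply: tame_add; first exact: tame_lcreateF.
    by rewrite -scaleN1r; apply: tame_scale; exact: tame_lannihF.
  exists (l i - ls i); split=> //; last first.
    by apply: tail_commutator => // j; exact: tail_commutator_gen.
  move=> x y yx; apply/funext => w.
  rewrite -[LHS]/((size w)%:R * (lcreate i x w + lannih q i x w)).
  rewrite -[RHS]/((lcreate i y w + lannih q i y w) + (lcreate i x w - lannih q i x w)) yx mulrDr.
  have := congr1 (fun f => f w) (num_lcreate i x); rewrite [LHS]/= !fctE /number_op => ->.
  have := congr1 (fun f => f w) (num_lannih i x); rewrite [LHS]/= !fctE /number_op => ->.
  ring.
- exists 0; split=> [|x y yx|B gB]; first exact: tame_zero.
    by rewrite addr0 yx.
  have lB := tame_linear (tame_alg tame_rgauss gB).
  have -> : commutator 0 B = 0; last exact: tail_zero.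
  by apply/funext => x; rewrite /commutator (lin0 lB) subrr.
- exists (A1 + A2); split=> [|x y yx|B gB]; first exact: tame_add.
    rewrite !fctE addrACA -[X in number_op X]/((a1 x : words) + (a2 x : words)).
    by rewrite (linD num_linear) (d1 _ _ yx) (d2 _ _ yx).
  have lB := tame_linear (tame_alg tame_rgauss gB).
  have -> : commutator (A1 + A2) B = commutator A1 B + commutator A2 B.
    by apply/funext => x; rewrite /commutator !fctE (linD lB) opprD addrACA.
  by apply: tail_add; [exact: h1|exact: h2].
- exists (c *: A1); split=> [|x y yx|B gB]; first exact: tame_scale.
    rewrite !fctE -scalerDr -[X in number_op X]/(c *: (a1 x : words)).
    by rewrite (linZ num_linear) (d1 _ _ yx).
  have lB := tame_linear (tame_alg tame_rgauss gB).
  have -> : commutator (c *: A1) B = c *: commutator A1 B.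
    by apply/funext => x; rewrite /commutator !fctE (linZ lB) scalerBr.
  exact/tail_scale/h1.
have ta1 := tame_alg tame_lgauss g1; have ta2 := tame_alg tame_lgauss g2.
exists ((a1 \o A2) + (A1 \o a2)); split=> [|x y yx|B gB].
- by apply: tame_add; exact: tame_comp.
- rewrite !fctE /= (d1 (a2 x) (a2 y + A2 x)) ?(d2 _ _ yx) //.
  by rewrite (linD (tame_linear ta1)) addrA.
have lB := tame_linear (tame_alg tame_rgauss gB).
have -> : commutator ((a1 \o A2) + (A1 \o a2)) B =
    (a1 \o commutator A2 B) + (commutator A1 B \o a2).
  apply/funext => x; rewrite /commutator !fctE /= (linD lB) (linB (tame_linear ta1)).
  by rewrite (lalg_ralg (A2 x) g1 gB) (lalg_ralg x g2 gB) opprD addrACA.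
by apply: tail_add; [apply: tail_compl => //; exact: h2|apply: tail_compr => //; exact: h1].
Qed.

End Commutators.

Definition supported n (x : words) := forall w, (n <= size w)%N -> x w = 0.

Lemma supported_decomp n x : supported n x ->
  x = \sum_(w <- words_below d n) (x : words) w *: delta w.
Proof.
move=> sx; rewrite -trunc_decomp; apply: Fval_inj; apply/funext => w.
by rewrite /= /trunc_words; case: ltnP => // /sx.
Qed.

Lemma alg_supported a : gen_alg lgauss a -> exists m, forall n x, supported n x ->
  supported (n + m) (a x : words).
Proof.
elim=> [i||a1 a2 _ [m1 h1] _ [m2 h2]|c a1 _ [m h]|a1 a2 _ [m1 h1] _ [m2 h2]].
- exists 1%N => n x sx w nw; rewrite -[LHS]/(lcreate i x w + lannih q i x w).
  rewrite [X in _ + X]/lannih big1 ?addr0 => [|k _]; last first.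
    rewrite sx ?mulr0 // size_insert_at.
    exact: leq_trans (leq_addr 1 n) (leqW nw).
  case: w nw => [|j w] //; rewrite addn1 ltnS => nw.
  by rewrite lcreate_cons sx ?mulr0.
- by exists 0%N => n x; rewrite addn0.
- exists (m1 + m2)%N => n x sx w nw; rewrite -[LHS]/((a1 x : words) w + (a2 x : words) w).
  rewrite (h1 _ _ sx) ?(h2 _ _ sx) ?addr0 //; apply: leq_trans nw; rewrite leq_add2l.
    exact: leq_addl.
  exact: leq_addr.
- exists m => n x sx w nw; rewrite -[LHS]/(c *: (a1 x : words) w).
  by rewrite (h _ _ sx) // scaler0.
- exists (m2 + m1)%N => n x sx; rewrite addnA; exact/h1/h2.
Qed.

Lemma supported_Omega : supported 1 Omega.
Proof. by move=> w w0; rewrite OmegaE -size_eq0 gtn_eqF. Qed.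

Lemma supported_basis_vec w : supported (size w).+1 (delta w).
Proof.
by move=> v wv; rewrite basis_vecE; case: eqP => // vw; rewrite vw ltnn in wv.
Qed.

Lemma lcreateF_basis_vec i w : l i (delta w) = delta (i :: w).
Proof.
apply: Fval_inj; rewrite lcreateFE; apply/funext => v; rewrite basis_vecE.
by case: v => [|j v] //; rewrite lcreate_cons basis_vecE -natrM mulnb eqseq_cons.
Qed.

Lemma supported_lannihF i n x : supported n.+1 x -> supported n (ls i x).
Proof.
move=> sx w nw; rewrite lannihFE /lannih big1 // => k _.
by rewrite sx ?mulr0 // size_insert_at.
Qed.

Lemma supported_leq m n (x : words) : (m <= n)%N -> supported m x -> supported n x.
Proof. by move=> mn sx w nw; apply: sx; exact: leq_trans nw. Qed.

(** Wick recursion: the tensor of the word i w is (l_i + l_i^* ) applied to that of w, minus l_i^*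
    of it, and the subtracted vector has lower degree. *)
Lemma wick_supported n x : supported n x -> exists2 W, gen_alg lgauss W & W Omega = x.
Proof.
elim: n x => [|n IHn] x sx.
  exists 0; first exact: alg_zero.
  by apply: Fval_inj; apply/funext => w; rewrite sx.
have base w : (size w < n.+1)%N -> exists2 W, gen_alg lgauss W & W Omega = delta w.
  case: w => [_|i w]; first by exists id; [exact: alg_one|rewrite Omega_delta].
  rewrite /= ltnS => wn.
  have sw := supported_leq wn (@supported_basis_vec w).
  have [W gW Wo] := IHn _ sw.
  have [W' gW' Wo'] := IHn _ (supported_lannihF i (supported_leq (leqnSn n) sw)).
  exists ((lgauss i \o W) + -1 *: W').
    by apply: alg_add; [apply: alg_mul => //; exact: alg_gen|exact: alg_scale].
  by rewrite !fctE /= Wo Wo' /lgauss fctE lcreateF_basis_vec scaleN1r addrK.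
rewrite [x](supported_decomp sx) big_seq.
elim/big_ind: _ => [|y z [Y gY <-] [Z gZ <-]|w].
- by exists 0; first exact: alg_zero.
- by exists (Y + Z); first exact: alg_add.
rewrite mem_words_below => /base[W gW <-].
by exists ((x : words) w *: W); first exact: alg_scale.
Qed.

(** [a] commutes with right multiplications, so it kills every [B Omega]; these include all
    truncations, which are dense. *)
Lemma alg_separating a : gen_alg lgauss a -> a Omega = 0 -> a = 0.
Proof.
move=> ga a0; have [la [M M0 hM] _ _] := tame_alg tame_lgauss ga.
have at0 K v : a (trunc q1 K v) = 0.
  have sv : supported K (trunc q1 K v : words).
    by move=> w wK; rewrite /= /trunc_words ltnNge wK.
  have [W gW Wo] := wick_supported sv; have [B gB Bo] := right_mult gW.
  by rewrite -Wo -Bo (lalg_ralg _ ga gB) a0 (lin0 (tame_linear (tame_alg tame_rgauss gB))).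
apply/funext => v; apply: (definite_hnorm D (@qdot_definite _ _ _ q1)).
apply/le_anti; rewrite hnorm_ge0 andbT.
have c0 : M * hn (v - trunc q1 K v) @[K --> \oo] --> (0 : R).
  by rewrite -[X in _ --> X](mulr0 M); apply: cvgMr; exact: hnorm_sub_trunc.
apply: (cvgr_to_ge c0); near=> K.
by rewrite -[a v]subr0 -(at0 K v) -(linB la).
Unshelve. all: by end_near. Qed.

(** * The algebra [Aq], the generator and the gradient form *)

Section Generator.
Variables (HR : vectType R) (ip : HR -> HR -> R) (e : 'I_d -> HR).
Hypothesis he : forall i j, ip (e i) (e j) = (i == j)%:R.
Local Notation Aq := (@Aq R HR ip d e q q1).

Lemma alg_Aq a : gen_alg lgauss a -> Aq a.
Proof.
elim=> [i||a1 a2 _ h1 _ h2|c a1 _ h|a1 a2 _ h1 _ h2].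
- apply: (@Aq_gaussian _ _ _ _ _ _ _ (e i)); last exact: lcreateF_adj.
  move=> x; rewrite lcreateFE /lcreate; congr create.
  by apply/rowP => j; rewrite !mxE he eqxx eq_sym /=; case: eqP.
- exact: Aq_one.
- exact: Aq_add.
- exact: Aq_scale.
- exact: Aq_mul.
Qed.

Lemma create_sum (xi : 'rV[C]_d) (x : F) :
  create xi x = (\sum_i xi 0 i *: l i x : F) :> words.
Proof.
apply/funext => w; rewrite Fsum_apply.
case: w => [|j w]; first by rewrite big1 // => i _; exact: scaler0.
rewrite (bigD1 j) //= big1 ?addr0 => [|i ij].
  by rewrite -[RHS]/(xi 0 j * lcreate j x (j :: w)) lcreate_cons eqxx mul1r.
by rewrite -[LHS]/(xi 0 i * lcreate i x (j :: w)) lcreate_cons eq_sym (negPf ij) mul0r mulr0.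
Qed.

(** [L] is determined by its values and [Ls] by uniqueness of the adjoint. The coordinates of a
    vector of H_R are real, so l_i and l_i^* receive the same coefficient and combine into
    [lgauss i]. *)
Lemma Aq_alg a : Aq a -> gen_alg lgauss a.
Proof.
elim=> [xi L Ls hL adjL||a1 a2 _ h1 _ h2|c a1 _ h|a1 a2 _ h1 _ h2|a1 a2 _ h1 adj]; last first.
- have [a' ga' adj'] := alg_adjoint lgauss_adj h1.
  by rewrite (adjoint_unique adj adj').
- exact: alg_mul.
- exact: alg_scale.
- exact: alg_add.
- exact: alg_one.
pose c i : C := (ip xi (e i))%:C.
have LE : L = \sum_i c i *: l i.
  apply/funext => x; apply: Fval_inj; rewrite hL create_sum fct_sumE.
  by congr qFock_val; apply: eq_bigr => i _; rewrite mxE.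
have adjS : is_adjoint dot (\sum_i c i *: l i) (\sum_i c i *: ls i).
  move=> x y; rewrite !fct_sumE (psd_suml D) (psd_sumr D); apply: eq_bigr => i _.
  by rewrite (psdZl D) (psdZr D) conj_realc lcreateF_adj.
rewrite LE in adjL *; rewrite (adjoint_unique adjL adjS) -big_split /=.
apply: alg_sum => i; rewrite -scalerDr; apply: alg_scale; exact: alg_gen.
Qed.

Variable Delta : (F -> F) -> (F -> F).
Hypothesis hDelta : is_OU_generator ip e Delta.

Lemma basis_vec_tensor w :
  delta w = tensor q1 (fun k : 'I_(size w) => delta_mx 0 (tnth (in_tuple w) k)).
Proof.
apply: Fval_inj; apply/funext => v; rewrite basis_vecE /= /embed.
case: insubP => [u /eqP su uv|]; last first.
  by move=> sv; case: eqP => // vw; rewrite vw eqxx in sv.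
rewrite /= /elem; have -> : (v == w) = (u == in_tuple w) by rewrite -val_eqE /= uv.
have [->|uw] := eqVneq u (in_tuple w).
  by rewrite big1 // => k _; rewrite mxE !eqxx.
have [k uk] : exists k, tnth u k != tnth (in_tuple w) k.
  apply/existsP; apply: contraNT uw => /existsPn h; apply/eqP/eq_from_tnth => k.
  by have := h k; rewrite negbK => /eqP.
by rewrite (bigD1 k) //= mxE (negPf uk) andbF mul0r.
Qed.

(** [a Omega] has finite support, so it is also the vacuum image of a combination of Wick words of
    basis tensors; the vacuum being separating, [a] equals that combination. *)
Lemma Delta_num a : Aq a -> Aq (Delta a) /\ Delta a Omega = number_op (a Omega) :> words.
Proof.
have [Dlin Dtens] := hDelta.
(* Membership of [Delta b] is carried along because [Psi] multiplies it on the right by [b], which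
   becomes [B] only for elements of [Aq]. *)
pose P b := [/\ Aq b, Aq (Delta b) & Delta b Omega = number_op (b Omega) :> words].
have P0 : P 0.
  have D0 : Delta 0 = 0.
    have := Dlin (-1) id id (Aq_one _ _ _) (Aq_one _ _ _).
    by rewrite scaleN1r addNr scaleN1r addNr.
  split; rewrite ?D0; try exact/alg_Aq/alg_zero.
  by apply/funext => w; rewrite /number_op mulr0.
have PD c b1 b2 : P b1 -> P b2 -> P (c *: b1 + b2).
  move=> [q11 d1 e1] [q12 d2 e2]; split; rewrite ?Dlin //.
  - by apply: Aq_add => //; exact: Aq_scale.
  - by apply: Aq_add => //; exact: Aq_scale.
  rewrite !fctE -[LHS]/(c *: (Delta b1 Omega : words) + (Delta b2 Omega : words)) e1 e2.
  by rewrite -num_linear.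
have Pw w : exists W, P W /\ W Omega = delta w.
  have [W gW Wo] := wick_supported (@supported_basis_vec w).
  exists W; split=> //; have qW := alg_Aq gW.
  have DW : Delta W = (size w)%:R *: W by apply: Dtens qW _; rewrite Wo basis_vec_tensor.
  split=> //; first by rewrite DW; exact: Aq_scale.
  by rewrite DW fctE Wo num_basis_vec.
move=> qa; have ga := Aq_alg qa; have [m hm] := alg_supported ga.
have sa := hm _ _ supported_Omega.
have [W WP] := choice Pw.
pose b := \sum_(w <- words_below d (1 + m)) (a Omega : words) w *: W w.
have Pb : P b.
  rewrite /b; elim/big_rec: _ => [|w z _ Pz]; first exact: P0.
  by apply: PD => //; have [] := WP w.
suff -> : a = b by have [] := Pb.
apply/eqP; rewrite -subr_eq0; apply/eqP/alg_separating.
  have [qb _ _] := Pb; rewrite -scaleN1r; apply: alg_add => //.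
  by apply: alg_scale; exact: Aq_alg.
rewrite !fctE; apply/eqP; rewrite subr_eq0; apply/eqP.
rewrite {1}(supported_decomp sa) /b fct_sumE; apply: eq_bigr => w _.
by have [_ <-] := WP w.
Qed.

(** At the vacuum, Delta(a x b) - a Delta(x b) gives A B x Omega and a Delta(x) b - Delta(a x) b
    gives - B A x Omega. The vector N B x Omega is Delta(x b) Omega, so N is only applied where it
    is known to be defined. *)
Lemma gradient_tail (t : R) a b : 0 < t -> t <= 1 -> `|q| <= t -> Aq a -> Aq b ->
  exists T, tail_ideal t T /\
    forall X, Aq X -> T (X Omega) = Psi Delta a b X Omega.
Proof.
move=> t0 t1 qt qa qb; have ga := Aq_alg qa.
have [B gB Bo] := right_mult (Aq_alg qb).
have [A [tA dA hA]] := number_derivation t0 t1 qt ga.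
exists (- (2^-1 : C) *: commutator A B); split; first by apply: tail_scale; exact: hA.
move=> X qx.
have tB := tame_linear (tame_alg tame_rgauss gB).
have bx c : Aq c -> c (b Omega) = B (c Omega).
  by move=> qc; rewrite -Bo (lalg_ralg _ (Aq_alg qc) gB).
have [qDx Dx] := Delta_num qx.
have [_ Daxb] := Delta_num (Aq_mul (Aq_mul qa qx) qb).
have [qDax Dax] := Delta_num (Aq_mul qa qx).
have [_ Dxb] := Delta_num (Aq_mul qx qb).
rewrite /Psi fctE; congr (_ *: _); rewrite !fctE /=.
rewrite (bx _ qDx) (bx _ qDax).
have -> : Delta (a \o X) Omega = a (Delta X Omega) + A (X Omega).
  by apply: Fval_inj; rewrite Dax; exact: dA.
have -> : Delta ((a \o X) \o b) Omega = a (Delta (X \o b) Omega) + A (B (X Omega)).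
  by apply: Fval_inj; rewrite Daxb /= (bx _ qx); apply: dA; rewrite Dxb /= (bx _ qx).
rewrite (linD tB) (lalg_ralg _ ga gB) /commutator.
move: (a _) (B (a _)) (A _) (B (A _)) => z1 z2 z3 z4.
by rewrite opprD addrA addrK -[z1 + z3 - z4]addrA addrAC subrr add0r.
Qed.

End Generator.

End GaussianAlgebra.

(** The rate is the midpoint between |q| and d^(-1/p), or 1 when p is infinite: the strict
    hypothesis leaves room for a positive rate. *)
Lemma exists_rate (R : realType) (d : nat) (q : R) (p : \bar R) :
  `|q| < 1 -> (1 <= p)%E -> (`|q|%:E < dim_root d p)%E ->
  exists t : R, [/\ 0 < t, t < 1, `|q| <= t &
    forall s : R, p = s%:E -> t `^ s * (maxn d 1)%:R < 1].
Proof.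
move=> ql1 p1 hq; case: p p1 hq => [s| |//]; last first.
  move=> _ _; exists ((`|q| + 1) / 2); have := normr_ge0 q.
  by split=> //; lra.
rewrite lee_fin => s1; have s0 : 0 < s by exact: lt_le_trans s1.
rewrite /dim_root (inver s) gt_eqF //= => hq.
pose m : R := (maxn d 1)%:R; have m1 : 1 <= m by rewrite ler1n leq_maxr.
have m0 : 0 < m by exact: lt_le_trans m1.
pose b := m `^ s^-1.
have b1 : 1 <= b by rewrite -(powRr0 m) ler_powR // invr_ge0 ltW.
have b0 : 0 < b by exact: lt_le_trans b1.
have qb : `|q| < b^-1.
  (* For d = 0 [dim_root] is infinite while m = 1, so the bound wanted is |q| < 1. *)
  case: d @m m1 m0 @b b1 b0 hq => [|d] m m1 m0 b b1 b0 hq.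
    by rewrite /b /m powR1 invr1.
  move: hq; rewrite /b /m (maxn_idPl _) //.
  by rewrite inver gt_eqF ?lte_fin // powR_gt0 // ltr0n.
exists ((`|q| + b^-1) / 2); have q0 := normr_ge0 q.
have bV1 : b^-1 <= 1 by rewrite invf_le1.
have bV0 : 0 < b^-1 by rewrite invr_gt0.
split; [lra|lra|lra|move=> _ [<-]].
have tb : (`|q| + b^-1) / 2 < b^-1 by lra.
suff bm : b^-1 `^ s * m = 1.
  rewrite -[ltRHS]bm ltr_pM2r // gt0_ltr_powR ?nnegrE ?(ltW bV0) //; lra.
rewrite -powR_inv1 ?(ltW b0) // -powRrM mulN1r /b -powRrM mulrN mulVf ?gt_eqF //.
by rewrite powR_inv1 ?(ltW m0) // mulVf // gt_eqF.
Qed.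

Theorem theoremB (R : realType) (HR : vectType R) (ip : {dot HR for idfun})
    (e : 'I_(\dim {:HR}) -> HR) (he : forall i j, ip (e i) (e j) = (i == j)%:R)
    (q : R) (q1 : -1 < q < 1) (p : \bar R) (p1 : (1 <= p)%E)
    (hq : (`|q|%:E < dim_root (\dim {:HR}) p)%E)
    (Delta : (qFock (\dim {:HR}) q1 -> qFock (\dim {:HR}) q1) ->
             (qFock (\dim {:HR}) q1 -> qFock (\dim {:HR}) q1))
    (hDelta : is_OU_generator ip e Delta) :
  gradient_schatten ip e Delta p.
Proof.
move=> a b qa qb.
have [t [t0 t1 qt tp]] := exists_rate (normq_lt1 q1) p1 hq.
have [T [tT TE]] := gradient_tail he hDelta t0 (ltW t1) qt qa qb.
exists T; split=> //; apply: schatten_of_tail t0 t1 _ tp tT.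
exact: lt_le_trans p1.
Qed.
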